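(* Let $G_1,\dots,G_n$ be nontrivial finitely generated groups. The free product $\ast_{i=1}^n G_i$ has $\mathrm{FGFP}_m$ if and only if every $G_i$ has $\mathrm{FGFP}_m$. Likewise, $\ast_{i=1}^n G_i$ has $\mathrm{FGFP}_a$ if and only if every $G_i$ has $\mathrm{FGFP}_a$.
   Context: A group $G$ has $\mathrm{FGFP}_m$ (resp. $\mathrm{FGFP}_a$) if for every injective endomorphism (resp. every automorphism) $f$ of $G$, the fixed subgroup $\operatorname{Fix}(f)=\{g\in G\mid f(g)=g\}$ is finitely generated. *)

(* Defs.v *)
From Stdlib Require Import List.
From mathcomp Require Import all_boot.

Set Implicit Arguments.
Unset Strict Implicit.

Record AbsGroup := {
  carrier :> Type;
  gmul : carrier -> carrier -> carrier;
  gone : carrier;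
  ginv : carrier -> carrier;
  gmulA : forall x y z, gmul x (gmul y z) = gmul (gmul x y) z;
  gmul1g : forall x, gmul gone x = x;
  gmulVg : forall x, gmul (ginv x) x = gone
}.

Arguments gmul {a}.
Arguments gone {a}.
Arguments ginv {a}.

(* group homomorphism (preservation of 1 and inverses follows) *)
Definition is_hom (G H : AbsGroup) (f : G -> H) : Prop :=
  forall x y : G, f (gmul x y) = gmul (f x) (f y).

Inductive gen (G : AbsGroup) (S : G -> Prop) : G -> Prop :=
| gen_in : forall x, S x -> gen S x
| gen_one : gen S gone
| gen_mul : forall x y, gen S x -> gen S y -> gen S (gmul x y)
| gen_inv : forall x, gen S x -> gen S (ginv x).

Definition fg_subgroup (G : AbsGroup) (A : G -> Prop) : Prop :=
  exists l : list G, forall x, A x <-> gen (fun y => In y l) x.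

Definition fg_group (G : AbsGroup) : Prop := fg_subgroup (fun _ : G => True).

Definition nontrivial (G : AbsGroup) : Prop := exists x : G, x <> gone.

Definition Fix (G : AbsGroup) (f : G -> G) : G -> Prop := fun g => f g = g.

Definition FGFP_m (G : AbsGroup) : Prop :=
  forall f : G -> G, is_hom f -> injective f -> fg_subgroup (Fix f).

Definition FGFP_a (G : AbsGroup) : Prop :=
  forall f : G -> G, is_hom f -> bijective f -> fg_subgroup (Fix f).

Definition is_free_product (I : Type) (Gs : I -> AbsGroup) (P : AbsGroup)
    (inj : forall i, Gs i -> P) : Prop :=
  (forall i, is_hom (inj i)) /\
  forall (H : AbsGroup) (f : forall i, Gs i -> H), (forall i, is_hom (f i)) ->
    exists h : P -> H,
      [/\ is_hom h,
          (forall i (x : Gs i), h (inj i x) = f i x)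
        & forall h' : P -> H, is_hom h' ->
            (forall i (x : Gs i), h' (inj i x) = f i x) ->
            forall y, h' y = h y].

(* Main.v *)
Require Import Defs.
From mathcomp Require Import all_boot.
From mathcomp Require Import boolp.
From mathcomp Require Import zify.

(* One direction: an endomorphism of a factor extends to the free product by the
   identity on the other factors, and the retraction onto the factor maps its
   fixed subgroup onto the given one.

   Conversely, by Grushko's theorem the free product P is a free product of
   finitely many freely indecomposable groups H_j, and by the first direction
   these inherit the property. Let f be an injective endomorphism of P. By
   Kurosh's theorem f(H_j) lies in a conjugate of some factor or is cyclic, and
   the subgroups {a in H_j | u f(a) u^-1 = a} are trivial or fixed subgroups of
   injective endomorphisms (automorphisms) of H_j. The argument of Goldstein and
   Turner is applied to the action p.u = p u f(p)^-1 of P on itself, in which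
   Fix f is the stabilizer of 1: pushing each u along the orbit of the factor of
   its first syllable is a flow with one outgoing edge per vertex, and only
   finitely many orbits of the factors are not compatible with this flow. *)

Set Implicit Arguments.
Unset Strict Implicit.
Unset Printing Implicit Defensive.

(** * Groups and subgroups *)

(* The original factors do not suffice for the converse, since [f] may spread the image of a factor
   over several of them. Indecomposability is what controls the normal form of [f a]. Let v = a.u
   with a <> 1 in the factor j, and suppose that neither u nor v starts with a syllable in j. Then
   [f a] = v^-1 a u is already reduced. If the factor is mapped into w^-1 X_k w, comparison with a
   reduced w^-1 c w makes u or v a suffix of w; otherwise the image is cyclic, and all syllables of
   [f a], among them a itself, lie in a fixed finite list. Either way only finitely many exceptions
   remain.

   Of Kurosh's theorem only two splittings are needed: H meets a factor in a free factor of H, and a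
   nontrivial H that meets no conjugate of a factor nontrivially has a nontrivial cyclic free
   factor. Both are checked against the universal property, by homomorphisms out of H built from
   cocycles on its cosets.

   The flag [b] carries both properties through one argument; for automorphisms, surjectivity has to
   be restored whenever a new map is built from [f]. *)
Declare Scope grp_scope.
Delimit Scope grp_scope with grp.
Bind Scope grp_scope with carrier.
Notation "x * y" := (gmul x y) : grp_scope.
Notation "x ^-1" := (ginv x) : grp_scope.
Notation "1" := gone : grp_scope.
Local Open Scope grp_scope.

Section GroupLaws.
Variable G : AbsGroup.
Implicit Types x y z : G.

Lemma gmulVKg x y : x^-1 * (x * y) = y.
Proof. by rewrite gmulA gmulVg gmul1g. Qed.

Lemma gmulgV x : x * x^-1 = 1.
Proof.
by rewrite -[LHS]gmul1g -{1}(gmulVg x^-1) -gmulA (gmulVKg x) gmulVg.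
Qed.

Lemma gmulg1 x : x * 1 = x.
Proof. by rewrite -(gmulVg x) gmulA gmulgV gmul1g. Qed.

Lemma gmulKVg x y : x * (x^-1 * y) = y.
Proof. by rewrite gmulA gmulgV gmul1g. Qed.

Lemma gmulI x y z : x * y = x * z -> y = z.
Proof. by move=> e; rewrite -(gmulVKg x y) e gmulVKg. Qed.

Lemma ginv1 : (1 : G)^-1 = 1.
Proof. by rewrite -[LHS]gmulg1 gmulVg. Qed.

Lemma ginvK x : x^-1^-1 = x.
Proof. by apply: (@gmulI x^-1); rewrite gmulgV gmulVg. Qed.

Lemma ginvM x y : (x * y)^-1 = y^-1 * x^-1.
Proof. by apply: (@gmulI (x * y)); rewrite gmulgV -gmulA gmulKVg gmulgV. Qed.

Lemma gmulAr x y z : (x * y) * z = x * (y * z).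
Proof. by rewrite gmulA. Qed.

(** The ten rules of the Knuth-Bendix completion of the group axioms, so rewriting with them decides
    identities valid in all groups. *)
Definition grpE :=
  (gmulAr, gmulVKg, gmulKVg, gmulgV, gmulVg, gmulg1, gmul1g, ginvM, ginvK, ginv1).

Lemma gmul_eq1 x y : x * y^-1 = 1 -> x = y.
Proof. by move=> e; rewrite -(gmul1g y) -e !grpE. Qed.

Lemma ginv_eq1 x : x^-1 = 1 -> x = 1.
Proof. by move=> e; rewrite -(ginvK x) e ginv1. Qed.

Record is_sub (A : G -> Prop) : Prop := IsSub {
  sub1 : A 1;
  subM : forall x y, A x -> A y -> A (x * y);
  subV : forall x, A x -> A x^-1 }.

Lemma sub_top : is_sub (fun _ => True). Proof. by []. Qed.

Lemma sub_triv : is_sub (fun x => x = 1).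
Proof. by split=> [//|x y -> ->|x ->]; rewrite ?grpE. Qed.

Lemma sub_setI A B : is_sub A -> is_sub B -> is_sub (fun x => A x /\ B x).
Proof.
move=> [A1 AM AV] [B1 BM BV]; split=> [//|x y [? ?] [? ?]|x [? ?]];
by split; auto.
Qed.

Lemma gen_is_sub (S : G -> Prop) : is_sub (gen S).
Proof. by split; [exact: gen_one | exact: gen_mul | exact: gen_inv]. Qed.

Lemma gen_min (S A : G -> Prop) : is_sub A -> (forall x, S x -> A x) ->
  forall x, gen S x -> A x.
Proof.
move=> [A1 AM AV] SA x; elim=> {x} [x /SA //|//|x y _ ? _ ?|x _ ?]; auto.
Qed.

Lemma gen_mono (S S' : G -> Prop) : (forall x, S x -> S' x) ->
  forall x, gen S x -> gen S' x.
Proof.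
by move=> h; apply: gen_min (gen_is_sub S') _ => x Sx; apply: gen_in; apply: h.
Qed.

Lemma fg_ext (A B : G -> Prop) : (forall x, A x <-> B x) ->
  fg_subgroup A -> fg_subgroup B.
Proof. by move=> AB [l hl]; exists l => x; rewrite -AB. Qed.

Lemma fg_triv : fg_subgroup (fun x : G => x = 1).
Proof.
exists nil => x; split=> [->|]; first exact: gen_one.
by apply: (gen_min sub_triv) => y [].
Qed.

Lemma fg_sub A : fg_subgroup A -> is_sub A.
Proof.
move=> [l hl]; split=> [|x y|x]; rewrite !hl; first exact: gen_one.
  exact: gen_mul.
exact: gen_inv.
Qed.

End GroupLaws.

(** Maps live on the whole carrier and are constrained only on [A], so that subgroups stay
    predicates; values off [A] are junk. *)
Definition homOn (G K : AbsGroup) (A : G -> Prop) (f : G -> K) :=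
  forall x y, A x -> A y -> f (x * y) = f x * f y.

Section HomOn.
Variables (G K : AbsGroup) (A : G -> Prop) (f : G -> K).
Hypotheses (sA : is_sub A) (hf : homOn A f).

Lemma homOn1 : f 1 = 1.
Proof.
by apply: (@gmulI _ (f 1)); rewrite -(hf (sub1 sA) (sub1 sA)) !grpE.
Qed.

Lemma homOnV x : A x -> f x^-1 = (f x)^-1.
Proof.
move=> Ax; apply: (@gmulI _ (f x)).
by rewrite -(hf Ax (subV sA Ax)) !grpE homOn1.
Qed.

Lemma sub_im : is_sub (fun y => exists2 x, A x & f x = y).
Proof.
split=> [|_ _ [x Ax <-] [y Ay <-]|_ [x Ax <-]].
- by exists 1; [exact: sub1 | exact: homOn1].
- by exists (x * y); [exact: subM | exact: hf].
- by exists x^-1; [exact: subV | exact: homOnV].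
Qed.

Lemma sub_preim (B : K -> Prop) : is_sub B -> is_sub (fun x => A x /\ B (f x)).
Proof.
move=> sB; split=> [|x y [Ax Bx] [Ay By]|x [Ax Bx]].
- by split; [exact: sub1 | rewrite homOn1; exact: sub1].
- by split; [exact: subM | rewrite hf //; exact: subM].
- by split; [exact: subV | rewrite homOnV //; exact: subV].
Qed.

Lemma sub_eqlz (g : G -> K) : homOn A g -> is_sub (fun x => A x /\ f x = g x).
Proof.
move=> hg.
have g1 : g 1 = 1.
  by apply: (@gmulI _ (g 1)); rewrite -(hg _ _ (sub1 sA) (sub1 sA)) !grpE.
split=> [|x y [Ax ex] [Ay ey]|x [Ax ex]].
- by split; [exact: sub1 | rewrite homOn1].
- by split; [exact: subM | rewrite hf // hg // ex ey].
split; first exact: subV.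
apply: (@gmulI _ (f x)); rewrite -(hf Ax (subV sA Ax)) ex.
by rewrite -(hg _ _ Ax (subV sA Ax)) !grpE homOn1 g1.
Qed.

Lemma homOn_gen (S : G -> Prop) x : (forall y, S y -> A y) -> gen S x ->
  gen (fun z => exists2 y, S y & f y = z) (f x).
Proof.
move=> SA gx.
suff [] : A x /\ gen (fun z => exists2 y, S y & f y = z) (f x) by [].
apply: (gen_min (sub_preim (gen_is_sub _)) _ gx) => y Sy.
by split; [exact: SA | apply: gen_in; exists y].
Qed.

Lemma fg_im : fg_subgroup A -> fg_subgroup (fun y => exists2 x, A x & f x = y).
Proof.
move=> [l hl]; exists (List.map f l) => y; split=> [[x Ax <-]|].
  have lA z : List.In z l -> A z by move=> zl; apply/hl; apply: gen_in.
  apply: gen_mono (homOn_gen lA _); last exact/hl.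
  by move=> _ [z zl <-]; apply: List.in_map.
apply: (gen_min sub_im).
move=> _ /List.in_map_iff [x [<- xl]]; exists x => //.
by apply/hl; apply: gen_in.
Qed.

End HomOn.

Lemma homOn_cst1 (G K : AbsGroup) (A : G -> Prop) : homOn A (fun _ : G => 1 : K).
Proof. by move=> x y _ _; rewrite grpE. Qed.

Lemma homOn_sub (G K : AbsGroup) (A B : G -> Prop) (f : G -> K) :
  (forall x, B x -> A x) -> homOn A f -> homOn B f.
Proof. by move=> BA hf x y /BA Ax /BA; apply: hf. Qed.

Lemma homOn_gen_eq (G K : AbsGroup) (A S : G -> Prop) (f g : G -> K) :
  is_sub A -> homOn A f -> homOn A g -> (forall x, S x -> A x) ->
  (forall x, S x -> f x = g x) -> forall x, gen S x -> f x = g x.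
Proof.
move=> sA hf hg SA fg x gx.
suff [] : A x /\ f x = g x by [].
by apply: (gen_min (sub_eqlz sA hf hg) _ gx) => y Sy; split; auto.
Qed.

Section SubGroup.
Variables (G : AbsGroup) (A : G -> Prop) (sA : is_sub A).

Lemma sig_eq (x y : {x : G | A x}) : sval x = sval y -> x = y.
Proof. exact: eq_sig_hprop (fun _ => @Prop_irrelevance _) x y. Qed.

(** Turns a subgroup into a legitimate target for the universal property. *)
Definition SubG : AbsGroup.
refine (@Build_AbsGroup {x : G | A x}
  (fun x y => exist _ (sval x * sval y) (subM sA (svalP x) (svalP y)))
  (exist _ 1 (sub1 sA)) (fun x => exist _ (sval x)^-1 (subV sA (svalP x))) _ _ _).
- by move=> x y z; apply: sig_eq => /=; rewrite gmulA.
- by move=> x; apply: sig_eq => /=; rewrite !grpE.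
- by move=> x; apply: sig_eq => /=; rewrite !grpE.
Defined.

End SubGroup.

Section SymGroup.
Variable T : Type.

Lemma perm_pair_eq (x y : {p : (T -> T) * (T -> T) | cancel p.1 p.2 /\ cancel p.2 p.1}) :
  (forall t, (sval x).1 t = (sval y).1 t) -> x = y.
Proof.
case: x y => [[f g] [/= fK gK]] [[f' g'] [/= fK' gK']] /= e.
have {}e : f = f' by apply: funext.
have eg : g = g' by apply: funext => t; rewrite -[t in LHS](gK') -e fK.
by subst; congr exist; apply: Prop_irrelevance.
Qed.

Definition SymG : AbsGroup.
refine (@Build_AbsGroup
  {p : (T -> T) * (T -> T) | cancel p.1 p.2 /\ cancel p.2 p.1}
  (fun p q => exist _ (fun t => (sval p).1 ((sval q).1 t),
                       fun t => (sval q).2 ((sval p).2 t)) _)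
  (exist _ (id, id) _) (fun p => exist _ ((sval p).2, (sval p).1) _) _ _ _).
Unshelve.
4: by case: p q => [[f g] [/= fK gK]] [[f' g'] [/= fK' gK']];
   split=> t /=; rewrite ?fK ?fK' ?gK' ?gK.
4: by [].
4: by case: p => [[f g] [/= fK gK]].
- by move=> x y z; apply: perm_pair_eq.
- by move=> x; apply: perm_pair_eq.
- by move=> [[f g] [/= fK gK]]; apply: perm_pair_eq => t /=.
Defined.

Definition mkSym (f g : T -> T) (fK : cancel f g) (gK : cancel g f) : SymG :=
  exist _ (f, g) (conj fK gK).

End SymGroup.

(* The wreath product [K wr G] over the right regular [G]-set: a homomorphism
   into it that lifts the identity of [G] is a cocycle [G -> G -> K]. *)
Definition WrG (G K : AbsGroup) : AbsGroup.
refine (@Build_AbsGroup ((G -> K) * G)%type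
  (fun p q => (fun u => p.1 u * q.1 (u * p.2), p.2 * q.2))
  (fun _ => 1, 1) (fun p => (fun u => (p.1 (u * p.2^-1))^-1, p.2^-1)) _ _ _).
- by move=> [a x] [b y] [c z] /=; congr pair; last exact: gmulA;
  apply: funext => u; rewrite !grpE.
- by move=> [a x] /=; congr pair; [apply: funext => u|]; rewrite !grpE.
- by move=> [a x] /=; congr pair; [apply: funext => u|]; rewrite !grpE.
Defined.

(** * Free products *)

(* Internal free product; generation replaces uniqueness in the universal property. *)
Record FP (G : AbsGroup) (A : G -> Prop) (I : Type) (X : I -> G -> Prop) : Prop :=
  MkFP {
    FP_sub : is_sub A;
    FP_factor : forall i, is_sub (X i);
    FP_incl : forall i x, X i x -> A x;
    FP_gen : forall x, A x -> gen (fun y => exists i, X i y) x;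
    FP_ext : forall (K : AbsGroup) (f : I -> G -> K), (forall i, homOn (X i) (f i)) ->
      exists h : G -> K, homOn A h /\ forall i x, X i x -> h x = f i x }.

Notation FP2 A B C := (FP A (fun b : bool => if b then B else C)).

(** The trivial group counts as indecomposable, so trivial factors may occur in decompositions
    below. *)
Definition indecomposable (G : AbsGroup) (A : G -> Prop) :=
  forall B C, FP2 A B C -> (forall x, B x -> x = 1) \/ (forall x, C x -> x = 1).

Section FreeProductUniversal.
Variables (I : Type) (Gs : I -> AbsGroup) (P : AbsGroup) (inj : forall i, Gs i -> P).
Hypothesis fp : is_free_product inj.

Lemma is_hom_homOn (G H : AbsGroup) (f : G -> H) : is_hom f <-> homOn (fun _ => True) f.
Proof. by split=> hf x y; auto; apply: hf. Qed.

(** A left inverse comes from the universal property: the identity (a cast along [j = i]) on one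
    factor, trivial on the others. *)
Lemma free_product_inj i : injective (@inj i).
Proof.
have [hinj ext] := fp.
pose f j : Gs j -> Gs i :=
  match pselect (j = i) with
  | left e => fun x => eq_rect j (fun k => Gs k : Type) x i e
  | right _ => fun _ => 1
  end.
have hf j : is_hom (f j).
  rewrite /f {f}; case: pselect => [e|_] x y; last by rewrite grpE.
  by case: i / e.
have [h [_ hE _]] := ext _ f hf.
move=> x y /(congr1 h); rewrite !hE /f; case: pselect => // e.
by rewrite (Prop_irrelevance e erefl).
Qed.

(** The identity of [P] and the composite of [P] -> [H] -> [P] both extend the injections;
    uniqueness makes them equal, and the composite takes values in the generated subgroup. *)
Lemma free_product_gen x : gen (fun y => exists i, exists z, @inj i z = y) x.
Proof.
have [hinj ext] := fp.
set S := (fun y => _).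
pose H := SubG (gen_is_sub S).
pose f i (z : Gs i) : H :=
  exist _ (inj z) (gen_in (ex_intro _ i (ex_intro _ z erefl)) : gen S (inj z)).
have hf i : is_hom (f i).
  by move=> y z; apply: sig_eq => /=; rewrite (hinj i).
have [h [hh hE _]] := ext H f hf.
have [k [_ _ uniqk]] := ext P inj hinj.
suff -> : x = sval (h x) by exact: svalP.
have e1 : x = k x by apply: (uniqk (fun z => z)).
rewrite {1}e1; apply/esym/(uniqk (fun z => sval (h z))) => [y z|i z].
  by rewrite hh.
by rewrite hE.
Qed.

Lemma FP_of_free_product :
  FP (fun _ : P => True) (fun i y => exists x, @inj i x = y).
Proof.
have [hinj ext] := fp.
split=> // [i|x _|K f hf]; first 1 last.
- exact: free_product_gen.
- have [i|h [hh hE _]] := ext K (fun i x => f i (inj x)).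
    by move=> x y; rewrite hinj; apply: hf; [exists x | exists y].
  exists h; split; first exact/is_hom_homOn.
  by move=> i _ [x <-]; rewrite hE.
have := sub_im (@sub_top (Gs i)) ((is_hom_homOn _).1 (hinj i)).
case=> s1 sM sV; split=> [|_ _ [x <-] [y <-]|_ [x <-]].
- by case: s1 => x _ <-; exists x.
- by have [|| z _ <-] := sM (inj x) (inj y); [exists x|exists y|exists z].
- by have [|z _ <-] := sV (inj x); [exists x | exists z].
Qed.

End FreeProductUniversal.


Lemma injOn_inv (G K : AbsGroup) (A : G -> Prop) (f : G -> K) :
  (forall x y, A x -> A y -> f x = f y -> x = y) ->
  exists g : K -> G, forall x, A x -> g (f x) = x.
Proof.
move=> fI.
have /choice [g gP] : forall y : K, exists x, (exists2 z, A z & f z = y) -> A x /\ f x = y.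
  move=> y; case: (EM (exists2 z, A z & f z = y)) => [[z Az <-]|h].
    by exists z.
  by exists 1.
exists g => x Ax; have [|Ag eg] := gP (f x); first by exists x.
exact: fI.
Qed.

Section FreeProductOps.
Variables (G : AbsGroup).
Implicit Types A B C : G -> Prop.

Lemma FP_trans A (I : Type) (X : I -> G -> Prop) (J : I -> Type)
    (Y : forall i, J i -> G -> Prop) :
  FP A X -> (forall i, FP (X i) (@Y i)) ->
  FP A (fun s : {i : I & J i} => @Y (tag s) (tagged s)).
Proof.
move=> fA fX; split=> [|[i j] /=|[i j] x /= xY|x /(FP_gen fA)|K f hf].
- exact: FP_sub fA.
- exact: FP_factor (fX i) j.
- exact: (FP_incl fA (FP_incl (fX i) xY)).
- apply: (gen_min (gen_is_sub _)) => y [i /(FP_gen (fX i))].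
  by apply: gen_mono => z [j Yz]; exists (Tagged J j).
have /choice [h hP] : forall i, exists h : G -> K, homOn (X i) h /\
    forall j x, Y i j x -> h x = f (Tagged J j) x.
  by move=> i; apply: (FP_ext (fX i)) => j; apply: (hf (Tagged J j)).
have [k [hk kE]] := FP_ext fA (fun i => (hP i).1).
exists k; split=> // -[i j] /= x Yx.
by rewrite (kE i) ?((hP i).2 j) //; apply: (FP_incl (fX i) Yx).
Qed.

Lemma FP_unit A : is_sub A -> FP A (fun _ : unit => A).
Proof.
move=> sA; split=> // [x Ax|K f hf]; first by apply: gen_in; exists tt.
by exists (f tt); split=> [|[]]; [exact: hf|].
Qed.

Lemma FP_retract A (I : Type) (X : I -> G -> Prop) i : FP A X ->
  exists r : G -> G, [/\ homOn A r, (forall x, A x -> X i (r x)),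
    (forall x, X i x -> r x = x) & (forall j x, j <> i -> X j x -> r x = 1)].
Proof.
move=> fA.
have [j|r [hr rE]] := @FP_ext _ _ _ _ fA G
  (fun j x => if pselect (j = i) then x else 1).
  by case: pselect => e x y Xx Xy //=; rewrite grpE.
exists r; split=> // [x /(FP_gen fA) gx|x Xx|j x ji Xx].
- have [] : A x /\ X i (r x); last by [].
  have sX := FP_factor fA i.
  apply: (gen_min (sub_preim (FP_sub fA) hr sX) _ gx) => y [j Xy].
  split; first exact: FP_incl Xy.
  by rewrite (rE _ _ Xy); case: pselect => [e|e] /=; [rewrite -e | exact: sub1].
- by rewrite (rE _ _ Xx); case: pselect.
- by rewrite (rE _ _ Xx); case: pselect.
Qed.

(** Transport along the isomorphism of [A] with its image; it lets a Kurosh splitting of the image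
    act on an indecomposable [A]. *)
Lemma FP_pullback (G' : AbsGroup) A (f : G -> G') (I : Type) (Y : I -> G' -> Prop) :
  is_sub A -> homOn A f -> (forall x y, A x -> A y -> f x = f y -> x = y) ->
  FP (fun y => exists2 x, A x & f x = y) Y ->
  FP A (fun i x => A x /\ Y i (f x)).
Proof.
move=> sA hf fI fY; have [g gK] := injOn_inv fI.
have gY i y : Y i y -> A (g y) /\ f (g y) = y.
  by move=> /(FP_incl fY) [x Ax <-]; rewrite gK.
split=> // [i|i x []//|x Ax|K k hk].
- exact: (sub_preim sA hf (FP_factor fY i)).
- have : gen (fun y => exists i, Y i y) (f x) by apply: (FP_gen fY); exists x.
  pose B := gen (fun y => exists i, A y /\ Y i (f y)).
  have BA z : B z -> A z by apply: gen_min => // u [i []].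
  move=> /(gen_min (sub_im (gen_is_sub _) (homOn_sub BA hf))) [].
    move=> y [i Yy]; have [Ag fg] := gY _ _ Yy.
    by exists (g y) => //; apply: gen_in; exists i; rewrite fg.
  by move=> z Bz /fI <- //; apply: BA.
have [i|h [hh hE]] := @FP_ext _ _ _ _ fY K (fun i y => k i (g y)).
  move=> x y Yx Yy; have [Ax fx] := gY _ _ Yx; have [Ay fy] := gY _ _ Yy.
  have -> : g (x * y) = g x * g y.
    by rewrite -{1}fx -{1}fy -hf // gK //; apply: subM.
  by apply: hk; rewrite ?fx ?fy.
exists (fun x => h (f x)); split=> [x y Ax Ay|i x [Ax Yx]].
  by rewrite hf // hh //; [exists x | exists y].
by rewrite (hE i _ Yx) gK.
Qed.

Lemma FP_equiv A A' (I : Type) (X X' : I -> G -> Prop) :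
  (forall x, A x <-> A' x) -> (forall i x, X i x <-> X' i x) -> FP A X -> FP A' X'.
Proof.
move=> eA eX.
have -> : A' = A by apply: funext => x; apply: propext; rewrite eA.
suff -> : X' = X by [].
by apply: funext => i; apply: funext => x; apply: propext; rewrite eX.
Qed.

End FreeProductOps.

(** * Normal forms *)

Section Words.
Variables (G : AbsGroup) (I : eqType).
Implicit Types (w u v : seq (I * G)) (i j : I) (x y : G).

Definition eval w : G := foldr (fun s g => s.2 * g) 1 w.
Definition winv w : seq (I * G) := rev (map (fun s => (s.1, s.2^-1)) w).
Definition first w : option I := ohead (unzip1 w).
Definition alt (s : seq I) : bool := sorted (fun i j => i != j) s.

Lemma eval_cat u v : eval (u ++ v) = eval u * eval v.
Proof. by elim: u => [|s u IH] /=; rewrite ?IH !grpE. Qed.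

Lemma winv_cons s w : winv (s :: w) = winv w ++ [:: (s.1, s.2^-1)].
Proof. by rewrite /winv /= rev_cons cats1. Qed.

Lemma eval_winv w : eval (winv w) = (eval w)^-1.
Proof.
by elim: w => [|s w IH]; rewrite ?winv_cons ?eval_cat ?IH /= !grpE.
Qed.

Lemma winvK : involutive winv.
Proof.
move=> w; rewrite /winv map_rev revK -map_comp -[RHS]map_id.
by apply: eq_map => -[i x] /=; rewrite ginvK.
Qed.

Lemma unzip1_winv w : unzip1 (winv w) = rev (unzip1 w).
Proof. by rewrite /winv /unzip1 map_rev -map_comp. Qed.

Lemma alt_cons i (s : seq I) : alt (i :: s) = (ohead s != Some i) && alt s.
Proof. by case: s => //= j s; rewrite eq_sym. Qed.

Lemma alt_catrev (s t : seq I) : alt s -> alt t ->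
  (forall i, ohead s = Some i -> ohead t <> Some i) -> alt (catrev s t).
Proof.
elim: s t => [//|i s IH] t; rewrite alt_cons => /andP [si as_] at_ st.
apply: IH => // [|j sj /= [ij]]; first by rewrite alt_cons at_ andbT; apply/eqP/st.
by rewrite ij sj eqxx in si.
Qed.

Variable X : I -> G -> Prop.

Fixpoint valid w : Prop :=
  if w is s :: w' then (X s.1 s.2 /\ s.2 <> 1) /\ valid w' else True.

Definition reduced w : Prop := valid w /\ alt (unzip1 w).

Lemma valid_cat u v : valid (u ++ v) <-> valid u /\ valid v.
Proof. by elim: u => [|s u IH] /=; tauto. Qed.

Lemma reduced_cons i x w :
  reduced ((i, x) :: w) <-> [/\ X i x, x <> 1, first w <> Some i & reduced w].
Proof.
rewrite /reduced [unzip1 _]/= alt_cons.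
split=> [[[[Xx x1] vw] /andP [/eqP fw aw]]|[Xx x1 fw [vw aw]]] //.
by split=> //; rewrite aw andbT; apply/eqP.
Qed.

Hypothesis sX : forall i, is_sub (X i).

Lemma valid_winv w : valid w -> valid (winv w).
Proof.
elim: w => [//|[i x] w IH] /= [[Xx x1] /IH vw].
rewrite winv_cons valid_cat; split=> //=; split=> //.
by split; [exact: (subV (sX i) Xx) | move=> /ginv_eq1].
Qed.

Lemma reduced_winv_cat v u : reduced v -> reduced u ->
  (forall i, first v = Some i -> first u <> Some i) -> reduced (winv v ++ u).
Proof.
move=> [vv av] [vu au] vuP; split; first by rewrite valid_cat; split=> //; apply: valid_winv.
by rewrite /unzip1 map_cat -!/unzip1 unzip1_winv -catrevE; apply: alt_catrev.
Qed.

Lemma reduced_winv w : reduced w -> reduced (winv w).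
Proof. by move=> rw; rewrite -[winv w]cats0; apply: reduced_winv_cat. Qed.

Lemma reduced_winv_cons v j a u : reduced v -> reduced u -> X j a -> a <> 1 ->
  first v <> Some j -> first u <> Some j -> reduced (winv v ++ (j, a) :: u).
Proof.
move=> rv ru Xa a1 fv fu; apply: reduced_winv_cat => // [|i fi [ij]].
  exact/reduced_cons.
by apply: fv; rewrite ij.
Qed.

Definition cons1 i x w := if `[< x = 1 >] then w else (i, x) :: w.

Definition push i x w : seq (I * G) :=
  if w is (j, y) :: w' then if j == i then cons1 i (x * y) w' else cons1 i x w
  else cons1 i x w.

Lemma cons1_1 i w : cons1 i 1 w = w.
Proof. by rewrite /cons1; case: asboolP. Qed.

Lemma eval_cons1 i x w : eval (cons1 i x w) = x * eval w.
Proof. by rewrite /cons1; case: asboolP => // ->; rewrite !grpE. Qed.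

Lemma reduced_cons1 i x w : X i x -> first w <> Some i -> reduced w ->
  reduced (cons1 i x w).
Proof. by rewrite /cons1; case: asboolP => // x1 Xx fw rw; apply/reduced_cons. Qed.

Lemma eval_push i x w : eval (push i x w) = x * eval w.
Proof.
by case: w => [|[j y] w] /=; [|case: eqP => _]; rewrite eval_cons1 /= ?grpE.
Qed.

(** Splits off a possibly trivial leading syllable [z] of index [i]; in this form [push i x] is just
    multiplication of [z] by [x], without case analysis. *)
Lemma cons1P i w : reduced w -> exists z w',
  [/\ X i z, first w' <> Some i, reduced w' & w = cons1 i z w'].
Proof.
have X1 := sub1 (sX i).
case: w => [|[j y] w] rw; first by exists 1, nil; rewrite cons1_1.
have [Xy y1 fw rw'] := (reduced_cons _ _ _).1 rw.
have [eji|ji] := eqVneq j i.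
  by exists y, w; rewrite -eji; split=> //; rewrite /cons1; case: asboolP.
by exists 1, ((j, y) :: w); split=> //; rewrite ?cons1_1 // => -[] /eqP; apply/negP.
Qed.

Lemma push_cons1 i x z w : first w <> Some i ->
  push i x (cons1 i z w) = cons1 i (x * z) w.
Proof.
rewrite /cons1; case: (asboolP (z = 1)) => [->|z1] fw; last by rewrite /= eqxx.
rewrite grpE; case: w fw => [|[j y] w] //= fw.
by case: eqP => // ji; case: fw; rewrite ji.
Qed.

Lemma reduced_push i x w : X i x -> reduced w -> reduced (push i x w).
Proof.
move=> Xx /(cons1P i) [z [w' [Xz fw rw ->]]]; rewrite push_cons1 //.
by apply: reduced_cons1 => //; apply: (subM (sX i)).
Qed.

Lemma push_push i x y w : reduced w -> push i x (push i y w) = push i (x * y) w.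
Proof. by move=> /(cons1P i) [z [w' [Xz fw rw ->]]]; rewrite !push_cons1 // gmulA. Qed.

Lemma push1 i w : reduced w -> push i 1 w = w.
Proof. by move=> /(cons1P i) [z [w' [Xz fw rw ->]]]; rewrite push_cons1 // grpE. Qed.

Lemma In_push i x w s : List.In s (push i x w) ->
  List.In s ((i, x) :: w ++ map (fun t => (i, x * t.2)) w).
Proof.
have cons1_In z u : List.In s (cons1 i z u) -> s = (i, z) \/ List.In s u.
  by rewrite /cons1; case: asboolP => _ /=; [right | case; [left|right]].
case: w => [|[j y] w] /=.
  by move=> /cons1_In [->|[]]; left.
have wi t : List.In t w -> List.In t (w ++ (i, x * y) :: map (fun t => (i, x * t.2)) w).
  by move=> tw; apply: List.in_or_app; left.
case: eqP => ji /cons1_In [->|].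
- by right; right; apply: List.in_or_app; right; left.
- by move=> sw; right; right; apply: wi.
- by left.
- by move=> /= [sw|sw]; right; [left | right; apply: wi].
Qed.

(** The elements which, together with their inverses, preserve having a reduced word under left
    multiplication form a subgroup, and [push] puts the factors inside it. *)
Lemma reduced_exists (A : G -> Prop) :
  (forall x, A x -> gen (fun y => exists i, X i y) x) ->
  forall x, A x -> exists2 w, reduced w & eval w = x.
Proof.
move=> gA x /gA.
pose N x := exists2 w, reduced w & eval w = x.
pose Q x := forall y, N y -> N (x * y) /\ N (x^-1 * y).
have sQ : is_sub Q.
  split=> [y|y z Qy Qz u Nu|y Qy u /Qy]; rewrite !grpE //; last by case.
  by split; [have [] := Qy _ (Qz _ Nu).1 | have [_] := Qz _ (Qy _ Nu).2].
have N1 : N 1 by exists nil.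
have QX z : (exists i, X i z) -> Q z.
  move=> [i Xz] _ [w rw <-]; split.
    by exists (push i z w); [exact: reduced_push | exact: eval_push].
  exists (push i z^-1 w); last exact: eval_push.
  by apply: reduced_push => //; apply: (subV (sX i)).
by move=> gx; have [] := gen_min sQ QX gx 1 N1; rewrite grpE.
Qed.

End Words.

(* van der Waerden: the factors act on reduced words by [push], and the induced
   action of [eval w] sends the empty word to [w]. *)
Lemma reduced_uniq (G : AbsGroup) (A : G -> Prop) (I : eqType) (X : I -> G -> Prop)
    (w w' : seq (I * G)) :
  FP A X -> reduced X w -> reduced X w' -> eval w = eval w' -> w = w'.
Proof.
move=> fA; have sX := FP_factor fA.
pose T := {w : seq (I * G) | reduced X w}.
have T_eq (t t' : T) : sval t = sval t' -> t = t'.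
  exact: eq_sig_hprop (fun _ => @Prop_irrelevance _) t t'.
pose pushT i x (Xx : X i x) (t : T) : T :=
  exist _ (push i x (sval t)) (reduced_push sX Xx (svalP t)).
have pushTK i x (Xx : X i x) y (Xy : X i y) : x * y = 1 ->
    cancel (pushT i y Xy) (pushT i x Xx).
  by move=> xy t; apply: T_eq => /=; rewrite (push_push sX) ?xy ?(push1 sX) //; apply: svalP.
pose f i x : SymG T :=
  match pselect (X i x) with
  | left Xx => mkSym (pushTK i _ (subV (sX i) Xx) x Xx (gmulVg x))
                     (pushTK i x Xx _ (subV (sX i) Xx) (gmulgV x))
  | right _ => 1
  end.
have fE i x t : X i x -> sval ((sval (f i x)).1 t) = push i x (sval t).
  by move=> Xx; rewrite /f; case: pselect.
have hf i : homOn (X i) (f i).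
  move=> x y Xx Xy; apply: perm_pair_eq => t; apply: T_eq.
  rewrite [RHS]/= !fE //; last exact: (subM (sX i)).
  by rewrite (push_push sX) //; apply: svalP.
have [h [hh hE]] := FP_ext fA hf.
pose nil0 : T := exist _ [::] (conj Logic.I isT).
have act u : reduced X u -> A (eval u) /\ sval ((sval (h (eval u))).1 nil0) = u.
  elim: u => [|[i x] u IH].
    by split; [exact: (sub1 (FP_sub fA)) | rewrite /= (homOn1 (FP_sub fA) hh)].
  move=> ru; have [Xx x1 fu /[dup] ru' /IH [Au hu]] := (reduced_cons _ _ _ _).1 ru.
  have Ax := FP_incl fA Xx; split; first by apply: (subM (FP_sub fA)).
  rewrite /= hh // (hE _ _ Xx) /= fE // hu.
  rewrite -[u in LHS](cons1_1 i) push_cons1 // grpE /cons1.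
  by case: asboolP.
by move=> /act [_ e] /act [_ e'] ee; rewrite -e -e' ee.
Qed.

Section NormalForm.
Variables (G : AbsGroup) (A : G -> Prop) (I : eqType) (X : I -> G -> Prop).
Hypothesis fA : FP A X.

Definition nf x : seq (I * G) :=
  match pselect (exists w, reduced X w /\ eval w = x) with
  | left h => sval (cid h)
  | right _ => [::]
  end.

Lemma nfP x : A x -> reduced X (nf x) /\ eval (nf x) = x.
Proof.
move=> Ax; rewrite /nf; case: pselect => [h|[]]; first by case: cid.
have [w rw ew] := reduced_exists (FP_factor fA) (FP_gen fA) Ax.
by exists w.
Qed.

Lemma eval_in w : valid X w -> A (eval w).
Proof.
elim: w => [_|[i x] w IH /= [[Xx _] /IH]]; first exact: (sub1 (FP_sub fA)).
by apply: (subM (FP_sub fA)); apply: (FP_incl fA Xx).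
Qed.

Lemma nf_eval w : reduced X w -> nf (eval w) = w.
Proof.
move=> rw; have [rn en] := nfP (eval_in rw.1).
exact: (reduced_uniq fA).
Qed.

Lemma nf1 : nf 1 = [::].
Proof. exact: (@nf_eval [::]). Qed.

End NormalForm.

(** Applying [f] syllable by syllable to a reduced word yields a reduced word of the same length,
    which is trivial only if it is empty. *)
Lemma FP_injective (G K : AbsGroup) (A : G -> Prop) (B : K -> Prop) (I : eqType)
    (X : I -> G -> Prop) (Y : I -> K -> Prop) (f : G -> K) :
  FP A X -> FP B Y -> homOn A f ->
  (forall i x, X i x -> Y i (f x)) -> (forall i x, X i x -> f x = 1 -> x = 1) ->
  forall x, A x -> f x = 1 -> x = 1.
Proof.
move=> fA fB hf fXY fX1 x Ax fx1.
have [] := nfP fA Ax; move: (nf X x) => w rw ew .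
pose w' := map (fun s => (s.1, f s.2)) w.
have rw' : reduced Y w'.
  split; last by rewrite /w' /unzip1 -map_comp; exact: rw.2.
  rewrite /w'; move: rw.1; clear -fXY fX1; elim: w => [//|[i y] w IH] /= [[Xy y1] /IH vw].
  by do 2!split => //; [exact: fXY | move=> /(fX1 _ _ Xy)].
have ew' : eval w' = f x.
  rewrite -ew /w'; move: rw.1; clear -fA hf; elim: w => [_|[i y] w IH] /=.
    by rewrite (homOn1 (FP_sub fA) hf).
  move=> [[Xy _] vw]; rewrite IH // hf //; first exact: (FP_incl fA Xy).
  exact: (eval_in fA).
have : w' = [::] by apply: (reduced_uniq fB) => //; rewrite ew' fx1.
by rewrite -ew /w'; case: (w).
Qed.

(** * Schreier transversals of subgroups of free products *)

Lemma exists_min (T : Type) (m : T -> nat) (Q : T -> Prop) :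
  (exists x, Q x) -> exists x, Q x /\ forall y, Q y -> (m x <= m y)%N.
Proof.
move=> [x0 Qx0].
have exm : exists n, `[< exists2 x, Q x & m x = n >] by exists (m x0); apply/asboolP; exists x0.
case: (ex_minnP exm) => n /asboolP [x Qx mx] nmin.
by exists x; split=> // y Qy; rewrite mx; apply: nmin; apply/asboolP; exists y.
Qed.

(* A choice that depends only on the extension of the predicate; junk value
   [x0] on an empty predicate. *)
Definition eps (T : Type) (x0 : T) (Q : T -> Prop) : T :=
  match pselect (exists x, Q x) with
  | left h => sval (cid h)
  | right _ => x0
  end.

Lemma epsP (T : Type) (x0 : T) (Q : T -> Prop) : (exists x, Q x) -> Q (eps x0 Q).
Proof. by move=> h; rewrite /eps; case: pselect => [h'|//]; case: cid. Qed.

Lemma eps_ext (T : Type) (x0 : T) (Q Q' : T -> Prop) :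
  (forall x, Q x <-> Q' x) -> eps x0 Q = eps x0 Q'.
Proof. by move=> QQ'; congr eps; apply: funext => x; apply: propext. Qed.

Section SchreierTransversal.
Variables (G : AbsGroup) (I : eqType) (X : I -> G -> Prop) (H : G -> Prop) (i0 : I).
Hypotheses (fG : FP (fun _ : G => True) X) (sH : is_sub H).

Let sX := FP_factor fG.
Let H1 := sub1 sH.
Let HM := @subM _ _ sH.
Let HV := @subV _ _ sH.

(** Depth of the coset [H u] in the coset graph; it orders the construction of the spanning tree. *)
Definition is_cdepth u n := (exists2 h, H h & size (nf X (h * u)) = n) /\
  forall h, H h -> (n <= size (nf X (h * u)))%N.

Lemma cdepth_exists u : exists n, is_cdepth u n.
Proof.
have [h [Hh hmin]] := @exists_min _ (fun h => size (nf X (h * u))) H (ex_intro _ _ H1).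
by exists (size (nf X (h * u))); split; [exists h | ].
Qed.

Definition cdepth u : nat := sval (cid (cdepth_exists u)).
Local Notation d := cdepth.

Lemma cdepth_le u h : H h -> (d u <= size (nf X (h * u)))%N.
Proof. by rewrite /cdepth; case: cid => n [_] /=; apply. Qed.

Lemma cdepth_ex u : exists2 h, H h & size (nf X (h * u)) = d u.
Proof. by rewrite /cdepth; case: cid => n []. Qed.

Lemma cdepthH h u : H h -> d (h * u) = d u.
Proof.
move=> Hh; apply/eqP; rewrite eqn_leq; apply/andP; split.
  have [k Hk <-] := cdepth_ex u.
  have := cdepth_le (h * u) (HM Hk (HV Hh)); by rewrite !grpE.
have [k Hk <-] := cdepth_ex (h * u).
by have := cdepth_le u (HM Hk Hh); rewrite !grpE.
Qed.

Lemma cdepth0 u : d u = 0%N <-> H u.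
Proof.
split=> [d0|Hu].
  have [h Hh] := cdepth_ex u; rewrite d0 => /size0nil nf0.
  have [_] := nfP fG (x := h * u) Logic.I; rewrite nf0 /= => e.
  by have -> : u = h^-1 * (h * u) by [rewrite !grpE]; rewrite -e grpE; apply: HV.
by have := cdepth_le u (HV Hu); rewrite gmulVg (nf1 fG) leqn0 => /eqP.
Qed.

(** Remove the last syllable of a shortest element of the coset. *)
Lemma cdepth_step u : ~ H u -> exists i x, X i x /\ (d (u * x) < d u)%N.
Proof.
move=> nHu; have [h Hh dh] := cdepth_ex u.
have [] := nfP fG (x := h * u) Logic.I.
move: dh; case/lastP: (nf X (h * u)) => [/esym /cdepth0 //|w [i x]].
rewrite size_rcons => <- [vw aw] ew.
move: vw; rewrite -cats1 valid_cat /= => -[vw [[Xx _] _]].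
exists i, x^-1; split; first exact: (subV (sX i)).
rewrite ltnS; apply: (leq_trans (cdepth_le _ Hh)).
rewrite gmulA -ew -cats1 eval_cat /= !grpE (nf_eval fG) //.
split=> //; move: aw; rewrite /alt /unzip1 map_rcons -cats1.
by move=> /cat_sorted2 [].
Qed.

(** The double coset [H u X_i]: these are the second kind of vertices of the bipartite coset graph,
    whose edges join [H u] to [H u X_i]. *)
Definition orbitR i u v := exists h x, [/\ H h, X i x & v = h * u * x].

Lemma orbitR_refl i u : orbitR i u u.
Proof. by exists 1, 1; rewrite !grpE; split=> //; exact: (sub1 (sX i)). Qed.

Lemma orbitR_sym i u v : orbitR i u v -> orbitR i v u.
Proof.
move=> [h [x [Hh Xx ->]]]; exists h^-1, x^-1; rewrite !grpE.
by split=> //; [exact: HV | exact: (subV (sX i))].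
Qed.

Lemma orbitR_trans i u v w : orbitR i u v -> orbitR i v w -> orbitR i u w.
Proof.
move=> [h [x [Hh Xx ->]]] [k [y [Hk Xy ->]]]; exists (k * h), (x * y); rewrite !grpE.
by split=> //; [exact: HM | exact: (subM (sX i))].
Qed.

Lemma orbitRH i h u : H h -> orbitR i u (h * u).
Proof. by move=> Hh; exists h, 1; rewrite !grpE; split=> //; exact: (sub1 (sX i)). Qed.

Lemma orbitRX i x u : X i x -> orbitR i u (u * x).
Proof. by move=> Xx; exists 1, x; rewrite gmul1g; split. Qed.

Definition orep i u : G :=
  eps 1 (fun v => orbitR i u v /\ forall v', orbitR i u v' -> (d v <= d v')%N).

Lemma orepP i u :
  orbitR i u (orep i u) /\ forall v, orbitR i u v -> (d (orep i u) <= d v)%N.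
Proof. exact: (epsP 1 (exists_min d (ex_intro (orbitR i u) u (orbitR_refl i u)))). Qed.

Lemma orep_eq i u v : orbitR i u v -> orep i v = orep i u.
Proof.
move=> uv; have vu := orbitR_sym uv; apply: eps_ext => w.
split=> -[vw h]; split=> [|w' ow].
- exact: orbitR_trans uv vw.
- by apply: h; apply: orbitR_trans vu ow.
- exact: orbitR_trans vu vw.
- by apply: h; apply: orbitR_trans uv ow.
Qed.

(* The type of the tree edge that joins [H u] to the base coset; [i0] has priority. *)
Definition ttype u : I :=
  eps i0 (fun i => (d (orep i u) < d u)%N /\ ((d (orep i0 u) < d u)%N -> i = i0)).

Lemma ttypeP u : ~ H u -> (d (orep (ttype u) u) < d u)%N /\
  ((d (orep i0 u) < d u)%N -> ttype u = i0).
Proof.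
move=> nHu; apply: (epsP i0 (Q := fun i => (d (orep i u) < d u)%N /\ ((d (orep i0 u) < d u)%N -> i = i0))).
case: (boolP (d (orep i0 u) < d u)%N) => h; first by exists i0.
have [i [x [Xx dx]]] := cdepth_step nHu; exists i; split=> //.
exact: (leq_ltn_trans ((orepP i u).2 _ (orbitRX u Xx))).
Qed.

Lemma ttypeH h u : H h -> ttype (h * u) = ttype u.
Proof.
move=> Hh; apply: eps_ext => i.
by rewrite !(orep_eq (orbitRH _ _ Hh)) cdepthH.
Qed.

(** The fuel [n] bounds the depth: the parent coset is strictly shallower, so [d u] is enough. [eps]
    selects a factor element leading from the parent's representative into [H u]. *)
Fixpoint schreier_rec n u : G :=
  if n is n'.+1 then
    if `[< H u >] then 1 else
    let v := schreier_rec n' (orep (ttype u) u) in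
    v * eps 1 (fun x => X (ttype u) x /\ H (v * x * u^-1))
  else 1.

Definition schreier u := schreier_rec (d u) u.
Local Notation s := schreier.

Lemma schreier_recE n u : (d u <= n)%N -> schreier_rec n u = s u.
Proof.
rewrite /schreier => dn; move: {2 3}(d u) (leqnn (d u)) => m.
elim: n m u dn => [|n IH] [|m] u //=.
- rewrite leqn0 => /eqP /cdepth0 Hu _; by case: asboolP.
- move=> _; rewrite leqn0 => /eqP /cdepth0 Hu; by case: asboolP.
move=> dn dm; case: asboolP => // nHu.
have [dr _] := ttypeP nHu.
by rewrite (IH m) // -ltnS; apply: (leq_trans dr).
Qed.

Lemma schreierE u : ~ H u -> s u = s (orep (ttype u) u) *
  eps 1 (fun x => X (ttype u) x /\ H (s (orep (ttype u) u) * x * u^-1)).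
Proof.
move=> nHu; have [dr _] := ttypeP nHu.
rewrite {1}/schreier; case du : (d u) => [|n] /=; first by rewrite du in dr.
case: asboolP => // _; rewrite schreier_recE // -ltnS -du.
by [].
Qed.

Lemma schreier1 u : H u -> s u = 1.
Proof. by move=> Hu; rewrite /schreier ((cdepth0 u).2 Hu). Qed.

Lemma schreier_ind (Q : G -> Prop) : (forall u, H u -> Q u) ->
  (forall u, ~ H u -> Q (orep (ttype u) u) -> Q u) -> forall u, Q u.
Proof.
move=> QH QS u; have [n] := ubnP (d u); elim: n u => // n IH u; rewrite ltnS => un.
case: (EM (H u)) => Hu; first exact: QH.
by apply: QS => //; apply: IH; apply: leq_trans un; have [] := ttypeP Hu.
Qed.

Lemma schreier_eps u : ~ H u -> H (s (orep (ttype u) u) * (orep (ttype u) u)^-1) ->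
  exists x, X (ttype u) x /\ H (s (orep (ttype u) u) * x * u^-1).
Proof.
move=> nHu; have [[h [x [Hh Xx e]]] _] := orepP (ttype u) u.
move=> IH; exists x^-1; split; first exact: (subV (sX _)).
by have := HM IH Hh; rewrite {2}e !grpE.
Qed.

Lemma schreier_coset u : H (s u * u^-1).
Proof.
elim/schreier_ind: u => u Hu; first by rewrite schreier1 // grpE; apply: HV.
by move=> /(schreier_eps Hu) /(epsP 1) []; rewrite -schreierE.
Qed.

Lemma schreier_step u : ~ H u ->
  exists x, X (ttype u) x /\ s u = s (orep (ttype u) u) * x.
Proof.
move=> nHu; have [Xx _] := epsP 1 (schreier_eps nHu (schreier_coset _)).
by rewrite schreierE //; eexists; split; first exact: Xx.
Qed.

(** All choices were made by [eps] from predicates that only see the coset [H u]. *)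
Lemma schreierH h u : H h -> s (h * u) = s u.
Proof.
move=> Hh; case: (EM (H u)) => Hu; first by rewrite !schreier1 //; apply: HM.
have Hhu : ~ H (h * u).
  by move=> /(HM (HV Hh)); rewrite !grpE.
rewrite (schreierE Hu) (schreierE Hhu) ttypeH // (orep_eq (orbitRH _ _ Hh)); congr gmul.
apply: eps_ext => x; split=> -[Xx Hx]; split=> //.
  by move: (HM Hx Hh); rewrite !grpE.
by move: (HM Hx (HV Hh)); rewrite !grpE.
Qed.

Lemma schreier_rep u : exists2 h, H h & s u = h * u.
Proof. by exists (s u * u^-1); [exact: schreier_coset | rewrite !grpE]. Qed.

(** The Schreier generator of the edge labelled [x] that leaves the coset [H u]; it is a cocycle in
    [x]. *)
Definition sgen u x := s u * x * (s (u * x))^-1.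
Local Notation sg := sgen.

Lemma sgen_in u x : H (sg u x).
Proof.
have := HM (schreier_coset u) (HV (schreier_coset (u * x))).
by rewrite /sgen !grpE.
Qed.

Lemma sgenM u x y : sg u (x * y) = sg u x * sg (u * x) y.
Proof. by rewrite /sgen !grpE. Qed.

Lemma sgenV u x : sg u x^-1 = (sg (u * x^-1) x)^-1.
Proof. by rewrite /sgen !grpE. Qed.

Lemma sgenH h u x : H h -> sg (h * u) x = sg u x.
Proof. by move=> Hh; rewrite /sgen (gmulAr h) !(schreierH _ Hh). Qed.

Lemma sgen1 h : H h -> sg 1 h = h.
Proof. by move=> Hh; rewrite /sgen gmul1g !schreier1 // !grpE. Qed.

(** By the cocycle rule, the [p] with [sg u p] in [Q] for every [u] form a subgroup; it contains the
    factors, hence everything, and [sg 1 h] is [h]. *)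
Lemma sgen_generate Q : is_sub Q -> (forall i u x, X i x -> Q (sg u x)) ->
  forall h, H h -> Q h.
Proof.
move=> sQ QX h Hh; rewrite -(sgen1 Hh) {Hh}; move: 1 => u.
have sQ' : is_sub (fun p => forall u, Q (sg u p)).
  split=> [v|p q Qp Qq v|p Qp v].
  - by rewrite /sgen !grpE; exact: (sub1 sQ).
  - by rewrite sgenM; apply: (subM sQ).
  - by rewrite sgenV; apply: (subV sQ).
apply: (gen_min sQ' _ (FP_gen fG (x := h) Logic.I)) => x [i Xx] v.
exact: QX Xx.
Qed.

(* A hom out of [H] from an [H]-invariant cocycle on [G] that is trivial along
   the edges of the Schreier tree. *)
Lemma sgen_hom (K : AbsGroup) (th : I -> G -> G -> K) :
  (forall i u x y, X i x -> X i y -> th i u (x * y) = th i u x * th i (u * x) y) ->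
  (forall i h u x, H h -> X i x -> th i (h * u) x = th i u x) ->
  (forall u x, ~ H u -> X (ttype u) x -> s u = s (orep (ttype u) u) * x ->
     th (ttype u) (orep (ttype u) u) x = 1) ->
  exists F : G -> K, homOn H F /\ forall i u x, X i x -> F (sg u x) = th i u x.
Proof.
move=> thM thH thT.
pose f i x : WrG G K := (fun u => th i u x, x).
have hf i : homOn (X i) (f i).
  by move=> x y Xx Xy; rewrite /f /gmul /=; congr pair; apply: funext => u; rewrite thM.
have [h [hh hE]] := FP_ext fG hf.
have h2 p : (h p).2 = p.
  apply: (homOn_gen_eq (f := fun q => (h q).2) (g := fun q => q) (@sub_top G) _ _ _ _
    (FP_gen fG (x := p) Logic.I)) => //.
  - by move=> x y _ _; rewrite hh.
  - by move=> x [i Xx]; rewrite (hE _ _ Xx).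
(* The base component of the wreath product: a cocycle on all of [G] extending [th]. Its value at
   the base coset restricts to a homomorphism on [H]. *)
pose T u p := (h p).1 u.
have TM u p q : T u (p * q) = T u p * T (u * p) q by rewrite /T hh //= h2.
have TX i u x : X i x -> T u x = th i u x by move=> Xx; rewrite /T (hE _ _ Xx).
have T1 u : T u 1 = 1 by rewrite /T (homOn1 (@sub_top G) hh).
have TV u p : T u p^-1 = (T (u * p^-1) p)^-1.
  by apply: gmul_eq1; rewrite ginvK -TM grpE T1.
have TH p : forall k u, H k -> T (k * u) p = T u p.
  have sT : is_sub (fun p => forall k u, H k -> T (k * u) p = T u p).
    split=> [k u _|x y Tx Ty k u Hk|x Tx k u Hk]; first by rewrite !T1.
      by rewrite !TM Tx // gmulAr Ty.
    by rewrite !TV gmulAr Tx.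
  apply: (gen_min sT _ (FP_gen fG (x := p) Logic.I)) => x [i Xx] k u Hk.
  by rewrite !(TX _ _ _ Xx) thH.
(* The path from the base coset to [s u] runs through tree edges only, and [thT] makes each of them
   contribute 1. *)
have Ts u : T 1 (s u) = 1.
  elim/schreier_ind: u => u Hu; first by rewrite schreier1.
  have [x [Xx e]] := schreier_step Hu; rewrite e TM => ->; rewrite !gmul1g.
  have [k Hk ->] := schreier_rep (orep (ttype u) u).
  by rewrite TH // (TX _ _ _ Xx) thT.
exists (T 1); split=> [k k' Hk Hk'|i u x Xx].
  by rewrite TM gmul1g -{2}(gmulg1 k) TH.
have e : T (sg u x) (s (u * x)) = 1.
  by rewrite -[sg u x]gmulg1 TH ?Ts //; apply: sgen_in.
have := TM 1 (sg u x) (s (u * x)); rewrite gmul1g e gmulg1 => <-.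
rewrite /sgen !grpE TM Ts !grpE (TX _ _ _ Xx).
by have [k Hk ->] := schreier_rep u; rewrite thH.
Qed.

End SchreierTransversal.

(** * Kurosh's theorem *)

Section Kurosh.
Variables (G : AbsGroup) (I : eqType) (X : I -> G -> Prop) (H : G -> Prop).
Hypotheses (fG : FP (fun _ : G => True) X) (sH : is_sub H).

Let sX := FP_factor fG.
Let HM := @subM _ _ sH.
Let HV := @subV _ _ sH.

Lemma schreier_tree i0 u r x :
  schreier X i0 sH u = schreier X i0 sH r * x ->
  (exists2 h, H h & r * x = h * u) /\ sgen X i0 sH r x = 1.
Proof.
have [k Hk ek] := schreier_rep i0 fG sH u; have [l Hl el] := schreier_rep i0 fG sH r.
move=> e; have e' : r * x = (l^-1 * k) * u.
  by rewrite gmulAr -ek e el !grpE.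
have Hlk : H (l^-1 * k) by apply: HM => //; apply: HV.
split; first by exists (l^-1 * k).
by rewrite /sgen e' schreierH // e !grpE.
Qed.

(** The Schreier generators on edges into the double coset of 1 lie in [H] and [X i0]; all the
    others generate the complement [Z]. *)
Lemma kurosh_factor i0 : exists Z, FP2 H (fun x => H x /\ X i0 x) Z.
Proof.
pose s := schreier X i0 sH; pose sg := sgen X i0 sH.
pose base u := orbitR X H i0 1 u.
(* Here the priority of [i0] in [ttype] matters: a coset in the base double coset is joined directly
   to the base coset, by an element of [X i0]. *)
have sbase u : base u -> X i0 (s u).
  move=> bu; case: (EM (H u)) => Hu; first by rewrite /s schreier1 //; exact: (sub1 (sX i0)).
  have du : (cdepth X sH (orep X sH i0 u) < cdepth X sH u)%N.
    rewrite (orep_eq fG sH bu); apply: (@leq_ltn_trans 0); last first.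
      by rewrite lt0n; apply/eqP => /(cdepth0 fG sH).
    have <- : cdepth X sH 1 = 0%N by apply/(cdepth0 fG sH); exact: (sub1 sH).
    exact: ((orepP fG sH i0 1).2 _ (orbitR_refl fG sH i0 1)).
  have tu : ttype X i0 sH u = i0 by have [_] := ttypeP i0 fG sH Hu; apply.
  have [x [Xx eu]] := schreier_step i0 fG sH Hu; rewrite /s eu; rewrite tu in Xx *.
  rewrite schreier1 ?gmul1g //; apply/(cdepth0 fG sH)/eqP.
  rewrite (orep_eq fG sH bu) -leqn0.
  have <- : cdepth X sH 1 = 0%N by apply/(cdepth0 fG sH); exact: (sub1 sH).
  exact: ((orepP fG sH i0 1).2 _ (orbitR_refl fG sH i0 1)).
have baseX u x : X i0 x -> base u -> base (u * x).
  by move=> Xx bu; apply: (orbitR_trans fG sH bu); apply: (orbitRX sH).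
have baseXV u x : X i0 x -> base (u * x) -> base u.
  by move=> Xx /(baseX _ _ (subV (sX i0) Xx)); rewrite !grpE.
have baseH h u : H h -> base u -> base (h * u).
  by move=> Hh bu; apply: (orbitR_trans fG sH bu); apply: (orbitRH fG).
pose S := fun z => exists i u x, [/\ X i x, i <> i0 \/ ~ base u & z = sg u x].
have sgX u x : X i0 x -> base u -> H (sg u x) /\ X i0 (sg u x).
  move=> Xx bu; split; first exact: sgen_in.
  apply: (subM (sX i0)); first by apply: (subM (sX i0)) => //; apply: sbase.
  by apply: (subV (sX i0)); apply: sbase; apply: baseX.
have SH z : gen S z -> H z.
  by apply: (gen_min sH) => _ [i [u [x [_ _ ->]]]]; apply: sgen_in.
exists (gen S); split=> //.
- by case; [exact: sub_setI | exact: gen_is_sub].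
- by case=> x; [case | exact: SH].
- apply: (sgen_generate fG (i0 := i0) (sH := sH) (gen_is_sub _)) => i u x Xx.
  apply: gen_in; case: (EM (i = i0 /\ base u)) => [[e bu]|ne].
    by exists true; subst i; apply: sgX.
  exists false; apply: gen_in; exists i, u, x; split=> //.
  by apply/not_andP.
move=> K f hf; have hp : homOn _ (f true) := hf true; have hq : homOn _ (f false) := hf false.
(* The two prescribed homomorphisms, each on its own edges. Tree edges have trivial Schreier
   generator, so the cocycle is trivial on them. *)
pose th i u x := if pselect (i = i0 /\ base u) then f true (sg u x) else f false (sg u x).
have thE1 u x : base u -> th i0 u x = f true (sg u x).
  by move=> bu; rewrite /th; case: pselect => // -[].
have thE2 i u x : i <> i0 \/ ~ base u -> th i u x = f false (sg u x).
  by rewrite -not_andE /th; case: pselect.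
have Ssg i u x : X i x -> i <> i0 \/ ~ base u -> gen S (sg u x).
  by move=> Xx ne; apply: gen_in; exists i, u, x.
have [|||F [hF FE]] := @sgen_hom _ _ _ _ i0 fG sH K th.
- move=> i u x y Xx Xy; case: (EM (i = i0 /\ base u)) => [[e bu]|/not_andP ne].
    subst i; have bux := baseX _ _ Xx bu.
    by rewrite !thE1 // /sg sgenM hp //; apply: sgX.
  have ne' : i <> i0 \/ ~ base (u * x).
    by case: (EM (i = i0)) => e; [right; subst i => /(baseXV _ _ Xx); case: ne | left].
  by rewrite !thE2 // /sg sgenM hq //; [apply: Ssg Xx ne | apply: Ssg Xy ne'].
- move=> i h u x Hh Xx; rewrite /th /sg sgenH //.
  case: pselect => [[e bu]|ne]; case: pselect => [[e' bu']|ne'] //.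
    case: ne'; split=> //; have := baseH h^-1 _ (HV Hh) bu; by rewrite !grpE.
  by case: ne; split=> //; apply: baseH.
- move=> u x Hu Xx /schreier_tree [_ e1]; rewrite /th /sg e1.
  case: pselect => ?; last exact: (homOn1 (gen_is_sub S) hq).
  exact: (homOn1 (sub_setI sH (sX i0)) hp).
exists F; split=> // -[] x.
  move=> [Hx Xx]; rewrite -{1}(sgen1 i0 fG sH Hx) (FE i0) // thE1 /sg ?sgen1 //.
  exact: (orbitR_refl fG).
apply: (homOn_gen_eq (gen_is_sub S) _ hq) => [|y Sy|y [i [u [v [Xv ne ->]]]]].
- exact: (homOn_sub SH hF).
- exact: gen_in.
- by rewrite (FE i) // thE2.
Qed.

Definition cyc (z : G) := gen (fun y => y = z).

(* If some edge [H r -- H r X_i] of the coset graph is not in the Schreier tree,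
   the loop it closes generates a free factor [cyc z]; if all edges are tree
   edges, [H] is generated by elements conjugate into the factors. *)
Lemma kurosh_cyclic :
  (forall i u x, X i x -> H (u * x * u^-1) -> x = 1) -> (exists h, H h /\ h <> 1) ->
  exists z N, z <> 1 /\ FP2 H (cyc z) N.
Proof.
move=> HX [h0 [Hh0 h01]].
have [i0 _] : exists i0 : I, True.
  case: (EM (exists i0 : I, True)) => // nI; case: h01.
  apply: (gen_min (@sub_triv G) _ (FP_gen fG (x := h0) Logic.I)) => x [i].
  by case: nI; exists i.
pose s := schreier X i0 sH; pose sg := sgen X i0 sH.
pose rep := orep X sH; pose tt := ttype X i0 sH.
(* The edge from [H u] to [H u X_i] is in the tree if [H u] contains the representative of the
   double coset, or if [i] is the type of the parent edge of [u]. If every edge is such, each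
   Schreier generator is a conjugate of a factor element, and [HX] kills it. *)
have [i1 [u0 [nr nt]]] : exists i u, ~ H (rep i u * u^-1) /\ ~ (~ H u /\ tt u = i).
  apply: contrapT => tree; apply: h01.
  apply: (@sgen_generate _ _ _ _ i0 fG sH _ (@sub_triv G)) Hh0 => i u x Xx.
  have rv v : orbitR X H i u v -> exists2 y, X i y & s v = s (rep i u) * y.
    move=> uv; rewrite /rep -(orep_eq fG sH uv) -/(rep i v).
    case: (EM (H (rep i v * v^-1))) => Hrv.
      exists 1; first exact: (sub1 (sX i)).
      have e : rep i v = (rep i v * v^-1) * v by rewrite !grpE.
      by rewrite gmulg1 e /s schreierH.
    case: (EM (~ H v /\ tt v = i)) => [[Hv tv]|ntv]; last by case: tree; exists i, v.
    have [y [Xy e]] := schreier_step i0 fG sH Hv; exists y; first by rewrite -tv.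
    by rewrite /s e -/tt tv.
  have [y Xy ey] := rv u (orbitR_refl fG sH i u).
  have [y' Xy' ey'] := rv _ (orbitRX sH u Xx).
  have := sgen_in i0 fG sH u x; rewrite /sgen -/s ey ey'.
  have Xyy : X i (y * x * y'^-1).
    apply: (subM (sX i)); first exact: (subM (sX i)).
    exact: (subV (sX i)).
  have -> : s (rep i u) * y * x * (s (rep i u) * y')^-1 =
    s (rep i u) * (y * x * y'^-1) * (s (rep i u))^-1 by rewrite !grpE.
  by move=> /(HX _ _ _ Xyy) ->; rewrite !grpE.
set r := rep i1 u0 in nr.
have [x0 Xx0 [h1 Hh1 ec]] : exists2 x0, X i1 x0 & exists2 h, H h & r * x0 = h * u0.
  have [[h [x [Hh Xx e]]] _] := orepP fG sH i1 u0.
  exists x^-1; first exact: (subV (sX i1)).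
  by exists h => //; rewrite /r /rep e !grpE.
set c := r * x0 in ec.
pose same u := exists2 k, H k & u = k * c.
have samec : same c by exists 1; [exact: (sub1 sH) | rewrite gmul1g].
have sameH k u : H k -> same (k * u) <-> same u.
  move=> Hk; split=> -[l Hl e]; last by exists (k * l); [exact: HM | rewrite e !grpE].
  by exists (k^-1 * l); [apply: HM => //; exact: HV | rewrite gmulAr -e !grpE].
have nsr : ~ same r.
  move=> [k Hk e]; case: nr; have -> : r * u0^-1 = k * h1; last exact: HM.
  by rewrite {1}e ec !grpE.
pose z := sg r x0.
pose S y := exists i u x, [/\ X i x, i <> i1 \/ (~ same u /\ ~ same (u * x)) & y = sg u x].
have SH y : gen S y -> H y.
  by apply: (gen_min sH) => _ [i [u [x [_ _ ->]]]]; apply: sgen_in.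
have Hz : H z by apply: sgen_in.
have cycH y : cyc z y -> H y by apply: (gen_min sH) => _ ->.
have sgk k u x : H k -> sg (k * u) x = sg u x by move=> Hk; rewrite /sg sgenH.
pose E (K : AbsGroup) (k : K) u := if pselect (same u) then k else 1.
have E1 (K : AbsGroup) (k : K) u : same u -> E K k u = k by rewrite /E; case: pselect.
have E0 (K : AbsGroup) (k : K) u : ~ same u -> E K k u = 1 by rewrite /E; case: pselect.
have EH (K : AbsGroup) (k : K) l u : H l -> E K k (l * u) = E K k u.
  move=> Hl; case: (EM (same u)) => su; first by rewrite !E1 //; apply/sameH.
  by rewrite !E0 // => /(sameH _ _ Hl).
(* Schreier generators after the representative of the coset of [c] is replaced by [s r * x0]. For
   the colour [i1] this makes [c] indistinguishable from [r], so [z] drops out of them. *)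
pose n u x := E G z u * sg u x * (E G z (u * x))^-1.
have nS u x : X i1 x -> gen S (n u x).
  have inS v y : X i1 y -> ~ same v -> ~ same (v * y) -> gen S (sg v y).
    by move=> Xy sv svy; apply: gen_in; exists i1, v, y; split=> //; right.
  move=> Xx; rewrite /n; have Xxv := subV (sX i1) Xx; have X0v := subV (sX i1) Xx0.
  have X0x := subM (sX i1) Xx0 Xx; have X0xv := subM (sX i1) Xx0 Xxv.
  case: (EM (same u)) => su; case: (EM (same (u * x))) => sux.
  - rewrite !E1 //; have [k Hk eu] := su; have [l Hl eux] := sux.
    have e : r * (x0 * x * x0^-1) = (k^-1 * l) * r.
      have -> : r * (x0 * x * x0^-1) = k^-1 * (u * x) * x0^-1.
        by rewrite eu /c !grpE.
      by rewrite eux /c !grpE.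
    have Hkl : H (k^-1 * l) by apply: HM => //; apply: HV.
    suff -> : z * sg u x * z^-1 = sg r (x0 * x * x0^-1).
      apply: inS => //; first exact: (subM (sX i1)).
      by rewrite e => /(sameH _ _ Hkl).
    rewrite /sg !sgenM sgenV -/sg -/z eu sgk //.
    congr (_ * _ * _^-1).
    have -> : r * (x0 * x) * x0^-1 = (k^-1 * l) * r by rewrite -e !grpE.
    by rewrite sgk.
  - rewrite E1 // E0 // ginv1 gmulg1; have [k Hk eu] := su.
    have -> : z * sg u x = sg r (x0 * x) by rewrite eu sgk // /sg sgenM.
    apply: inS => // srx; apply: sux; rewrite eu gmulAr; apply/sameH => //.
    by move: srx; rewrite gmulA.
  - rewrite E0 // E1 // gmul1g; have [l Hl eux] := sux.
    have eu : u = l * (r * (x0 * x^-1)).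
      have -> : u = (u * x) * x^-1 by rewrite !grpE.
      by rewrite eux /c !grpE.
    have -> : sg u x * z^-1 = (sg r (x0 * x^-1))^-1.
      have e0 : z = sg r (x0 * x^-1) * sg (r * (x0 * x^-1)) x.
        by rewrite /sg -sgenM !grpE.
      by rewrite e0 eu sgk // ginvM gmulKVg.
    apply: (subV (gen_is_sub S)); apply: inS => // srx.
    by apply: su; rewrite eu; apply/sameH.
  - by rewrite !E0 // ginv1 gmulg1 gmul1g; apply: inS.
have nM u x y : n u (x * y) = n u x * n (u * x) y by rewrite /n /sg sgenM !grpE.
have ext (K : AbsGroup) (k : K) (q : G -> K) : homOn (gen S) q ->
    exists F, [/\ homOn H F, F z = k & forall x, gen S x -> F x = q x].
  move=> hq; have q1 : q 1 = 1 := homOn1 (gen_is_sub S) hq.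
  (* Undoing the change of representative with [k] in place of [z] gives the loop the prescribed
     value [k] and keeps [q] on the other generators. *)
  pose th i u x := if i == i1 then (E K k u)^-1 * q (n u x) * E K k (u * x) else q (sg u x).
  have [|||F [hF FE]] := @sgen_hom _ _ _ _ i0 fG sH K th.
  - move=> i u x y Xx Xy; rewrite /th; case: eqP => [e|ne].
      by subst i; rewrite nM hq ?grpE //; apply: nS.
    rewrite /sg sgenM hq //; apply: gen_in; [exists i, u, x | exists i, (u * x), y];
      by split=> //; left.
  - move=> i l u x Hl Xx; by rewrite /th /n sgk // (gmulAr l) !(EH _ _ _ _ Hl).
  - move=> u x Hu Xx /schreier_tree [[l Hl el] e1]; rewrite /th.
    rewrite /sg; case: eqP => [tu|_]; last by rewrite e1.
    rewrite tu in el e1 *.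
    have ns : ~ same (orep X sH i1 u).
      move=> [m Hm em]; case: nsr.
      suff -> : r = orep X sH i1 u by exists m.
      rewrite /r /rep; apply: (orep_eq fG sH).
      apply: (orbitR_trans fG sH (orepP fG sH i1 u).1); rewrite em.
      apply: (orbitR_sym fG sH); exists (m * h1), 1; split; first exact: HM.
        exact: (sub1 (sX i1)).
      by rewrite ec !grpE.
    have ns' : ~ same (orep X sH i1 u * x).
      rewrite el => /(sameH _ _ Hl) [m Hm eu]; apply: nt.
      have eu' : u = (m * h1) * u0 by rewrite eu ec !grpE.
      have Hmh : H (m * h1) by apply: HM.
      split; first by move=> Hu0; apply: Hu; rewrite eu'; apply: HM.
      by rewrite -tu /tt eu' ttypeH.
    by rewrite /n !E0 // /sg e1 !grpE q1.
  exists F; split=> //.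
    rewrite /z /sg (FE i1) // /th eqxx /n -/c E0 // E0 // E1 // E1 //.
    by rewrite -/z !grpE q1 ?grpE.
  apply: (homOn_gen_eq (gen_is_sub S) _ hq) => [|y|y [i [u [x [Xx ne ->]]]]].
  - exact: (homOn_sub SH hF).
  - exact: gen_in.
  rewrite /sg (FE i) // /th; case: eqP => // e; case: ne => [//|[su sux]].
  by rewrite /n !E0 // !grpE.
exists z, (gen S); split.
  (* Prescribing the nontrivial value [h0] at [z] shows that [z] is nontrivial. *)
  move=> z1; have [F [hF Fz _]] := ext G h0 _ (homOn_cst1 G (A := gen S)).
  by apply: h01; rewrite -Fz z1 (homOn1 sH hF).
split=> //.
- by case; exact: gen_is_sub.
- by case=> x; [exact: cycH | exact: SH].
- set U := gen _; have Uz : U z by apply: gen_in; exists true; apply: gen_in.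
  have US y : gen S y -> U y by move=> Sy; apply: gen_in; exists false.
  have sU : is_sub U := gen_is_sub _.
  apply: (sgen_generate fG (i0 := i0) (sH := sH) sU) => i u x Xx.
  have [e|/eqP ne] := eqVneq i i1; last first.
    by apply: US; apply: gen_in; exists i, u, x; split=> //; left.
  subst i; have -> : sgen X i0 sH u x = (E G z u)^-1 * n u x * E G z (u * x).
    by rewrite /n !grpE.
  have UE v : U (E G z v) by rewrite /E; case: pselect => ? //; exact: (sub1 sU).
  apply: (subM sU) => //; apply: (subM sU); first exact: (subV sU).
  by apply: US; apply: nS.
move=> K f hf; have hp : homOn (cyc z) (f true) := hf true.
have [F [hF Fz FS]] := ext K (f true z) (f false) (hf false).
exists F; split=> // -[] x; last exact: FS.
apply: (homOn_gen_eq (gen_is_sub _) _ hp) => [|y|y ->] //; last exact: gen_in.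
exact: (homOn_sub cycH hF).
Qed.

End Kurosh.

(** * Fixed subgroups and free factors *)

(* [b = false]: injective endomorphisms of [A]; [b = true]: automorphisms. *)
Definition FGFPon (b : bool) (G : AbsGroup) (A : G -> Prop) :=
  forall f : G -> G, homOn A f -> (forall x, A x -> A (f x)) ->
  (forall x y, A x -> A y -> f x = f y -> x = y) ->
  (b -> forall y, A y -> exists2 x, A x & f x = y) ->
  fg_subgroup (fun x => A x /\ f x = x).

Lemma FGFPon_m (G : AbsGroup) : FGFP_m G <-> FGFPon false (fun _ : G => True).
Proof.
split=> [fg f hf _ fI _|fg f hf fI].
  apply: (fg_ext _ (fg f _ _)) => [x|x y|x y]; [by split=> [|[]]| exact: hf | exact: fI].
apply: (fg_ext _ (fg f _ _ _ _)) => // [x|x y _ _]; last exact: fI.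
by split=> [[]|].
Qed.

Lemma FGFPon_a (G : AbsGroup) : FGFP_a G <-> FGFPon true (fun _ : G => True).
Proof.
split=> [fg f hf _ fI fS|fg f hf [g fK gK]].
  have [|g gP] := @choice _ _ (fun y x => f x = y).
    by move=> y; have [x _ <-] := fS isT y Logic.I; exists x.
  apply: (fg_ext _ (fg f _ _)) => [x|x y|]; [by split=> [|[]]| exact: hf |].
  by exists g => // x; apply: fI.
apply: (fg_ext _ (fg f _ _ _ _)) => // [x|x y _ _|_ y _].
- by split=> [[]|].
- exact: (can_inj fK).
- by exists (g y).
Qed.

(** An endomorphism [k] of the image is conjugated back to [g] after [k] after [f] on [A], and [f]
    maps the one fixed subgroup onto the other. *)
Lemma FGFPon_im b (G K : AbsGroup) (A : G -> Prop) (f : G -> K) :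
  is_sub A -> homOn A f -> (forall x y, A x -> A y -> f x = f y -> x = y) ->
  FGFPon b A -> FGFPon b (fun y => exists2 x, A x & f x = y).
Proof.
move=> sA hf fI fgA k hk kA kI kS; have [g gK] := injOn_inv fI.
have imA x : A x -> exists2 z, A z & f z = f x by exists x.
have fgk x : A x -> A (g (k (f x))) /\ f (g (k (f x))) = k (f x).
  by move=> /imA /kA [z Az <-]; rewrite gK.
have hB : homOn (fun x => A x /\ g (k (f x)) = x) f by apply: homOn_sub hf => x [].
have sB : is_sub (fun x => A x /\ g (k (f x)) = x).
  split=> [|x y [Ax ex] [Ay ey]|x [Ax ex]].
  - split; first exact: (sub1 sA).
    by rewrite (homOn1 sA hf) (homOn1 (sub_im sA hf) hk) -(homOn1 sA hf) gK //; exact: (sub1 sA).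
  - split; first exact: (subM sA).
    have [A1 e1] := fgk _ Ax; have [A2 e2] := fgk _ Ay.
    rewrite hf // hk; [|exact: imA|exact: imA].
    by rewrite -e1 -e2 -hf // gK ?ex ?ey //; apply: (subM sA).
  - split; first exact: (subV sA).
    have [A1 e1] := fgk _ Ax.
    rewrite (homOnV sA hf) // (homOnV (sub_im sA hf) hk); last exact: imA.
    by rewrite -e1 -(homOnV sA hf) // gK ?ex //; apply: (subV sA).
apply: (fg_ext _ (fg_im sB hB _)) => [y|].
  split=> [[x [Ax ex] <-]|[[x Ax <-] ek]].
    by split; [exact: imA | rewrite -{2}ex; case: (fgk _ Ax) => _ ->].
  by exists x => //; split=> //; rewrite ek gK.
apply: fgA => [x y Ax Ay|x /fgk []//|x y Ax Ay exy|bT y Ay].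
- rewrite hf // hk; [|exact: imA|exact: imA].
  have [A1 e1] := fgk _ Ax; have [A2 e2] := fgk _ Ay.
  by rewrite -{1}e1 -{1}e2 -hf // gK //; apply: (subM sA).
- have [A1 e1] := fgk _ Ax; have [A2 e2] := fgk _ Ay.
  apply: fI => //; apply: kI; [exact: imA|exact: imA|].
  by rewrite -e1 -e2 exy.
- have [_ [x Ax <-] ekx] := kS bT _ (imA _ Ay).
  by exists x => //; rewrite ekx gK.
Qed.

Lemma FGFPon_factor b (G : AbsGroup) (A : G -> Prop) (I : eqType) (X : I -> G -> Prop) i :
  FP A X -> FGFPon b A -> FGFPon b (X i).
Proof.
move=> fA fgA f hf fX fI fS.
have sA := FP_sub fA; have sX := FP_factor fA.
have [|h [hh hE]] := @FP_ext _ _ _ _ fA G (fun j x => if j == i then f x else x).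
  by move=> j; case: eqP => [->|_] //.
have hXi x : X i x -> h x = f x by move=> Xx; rewrite (hE _ _ Xx) eqxx.
have hXj j x : j <> i -> X j x -> h x = x.
  by move=> ne Xx; rewrite (hE _ _ Xx); case: eqP.
have hXX j x : X j x -> X j (h x).
  have [->|/eqP ne] := eqVneq j i => Xx; first by rewrite hXi //; apply: fX.
  by rewrite (hXj j).
have f1 : f 1 = 1 := homOn1 (sX i) hf.
have h_ker x : A x -> h x = 1 -> x = 1.
  apply: (FP_injective fA fA hh) => // j y Xy.
  have [e|/eqP ne] := eqVneq j i; last by rewrite (hXj j).
  by subst j; rewrite hXi // -{1}f1 => /fI; apply=> //; exact: (sub1 (sX i)).
have hA x : A x -> A (h x).
  move=> /(FP_gen fA) gx; suff [] : A x /\ A (h x) by [].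
  apply: (gen_min (sub_preim sA hh sA) _ gx) => y [j Xy].
  by split; [exact: (FP_incl fA Xy) | exact: (FP_incl fA (hXX _ _ Xy))].
have [r [hr rX rid r1]] := FP_retract i fA.
have sF : is_sub (fun x => A x /\ h x = x) by apply: (sub_eqlz sA hh).
(* This intertwining puts the image of the fixed subgroup of [h] under [r] inside that of [f]. *)
have rh x : A x -> r (h x) = f (r x).
  move=> Ax; apply: (homOn_gen_eq sA (f := fun x => r (h x)) (g := fun x => f (r x)))
    (FP_gen fA Ax) => [y z Ay Az|y z Ay Az|y [j Xy]|y [j Xy]].
  - by rewrite hh // hr //; apply: hA.
  - by rewrite hr // hf //; apply: rX.
  - exact: (FP_incl fA Xy).
  have [e|/eqP ne] := eqVneq j i; first by subst j; rewrite hXi // !rid //; apply: fX.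
  by rewrite (hXj j) // (r1 j) // f1.
have hrF : homOn (fun x => A x /\ h x = x) r by apply: homOn_sub hr => x [].
apply: (fg_ext _ (fg_im sF hrF _)) => [y|].
  split=> [[x [Ax hx] <-]|[Xy fy]]; first by split; [exact: rX | rewrite -rh // hx].
  by exists y; [split; [exact: (FP_incl fA Xy) | rewrite hXi] | exact: rid].
apply: fgA => // [x y Ax Ay hxy|bT y Ay].
  apply: gmul_eq1; apply: h_ker; first by apply: (subM sA) => //; apply: (subV sA).
  by rewrite hh // ?(homOnV sA hh) // ?hxy ?grpE //; apply: (subV sA).
apply: (gen_min (sub_im sA hh) _ (FP_gen fA Ay)) => {Ay}y [j Xy].
have [e|/eqP ne] := eqVneq j i.
  subst j; have [x Xx <-] := fS bT _ Xy; exists x; last exact: hXi.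
  exact: (FP_incl fA Xx).
by exists y; [exact: (FP_incl fA Xy) | exact: hXj Xy].
Qed.

Section Indecomposable.
Variables (G : AbsGroup) (I : eqType) (X : I -> G -> Prop).
Hypothesis fG : FP (fun _ : G => True) X.
Variables (A : G -> Prop) (f : G -> G).
Hypotheses (sA : is_sub A) (iA : indecomposable A).
Hypotheses (hf : homOn (fun _ => True) f) (fI : injective f).

Let hfA : homOn A f. Proof. exact: homOn_sub hf. Qed.
Let fIA x y : A x -> A y -> f x = f y -> x = y. Proof. by move=> _ _; apply: fI. Qed.

(** The splitting of the image pulls back to one of [A]; its first factor contains [a], so the
    second one is trivial. *)
Lemma indecomposable_im B C : FP2 (fun y => exists2 x, A x & f x = y) B C ->
  (exists a, [/\ A a, a <> 1 & B (f a)]) -> forall a, A a -> B (f a).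
Proof.
move=> fH [a0 [Aa0 a01 Ba0]] a Aa.
have sB := FP_factor fH true.
have fAA : FP2 A (fun x => A x /\ B (f x)) (fun x => A x /\ C (f x)).
  by apply: FP_equiv (FP_pullback sA hfA fIA fH) => // -[].
have [t|t] := iA fAA; first by case: a01; apply: t.
have sBA := FP_factor fAA true.
suff [] : A a /\ B (f a) by [].
apply: (gen_min sBA _ (FP_gen fAA Aa)) => x [] [] // Cx.
by rewrite (t x Cx); exact: (sub1 sBA).
Qed.

(** By [kurosh_factor] the intersection of the image with [X i] is a free factor of the image; being
    nontrivial, it is everything. *)
Lemma indecomposable_elliptic i :
  (exists a, [/\ A a, a <> 1 & X i (f a)]) -> forall a, A a -> X i (f a).
Proof.
move=> [a0 [Aa0 a01 Xa0]] a Aa.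
have [Z fH] := kurosh_factor fG (sub_im sA hfA) i.
have [|_ //] := indecomposable_im fH _ Aa.
by exists a0; split=> //; split=> //; exists a0.
Qed.

(** An image that meets no conjugate of a factor has a nontrivial cyclic free factor, which
    indecomposability makes the whole image. *)
Lemma indecomposable_hyperbolic :
  (exists a, A a /\ a <> 1) ->
  (forall i u a, A a -> X i (u^-1 * f a * u) -> a = 1) ->
  exists2 z, A z & forall a, A a -> cyc (f z) (f a).
Proof.
have f1 : f 1 = 1 := homOn1 (@sub_top G) hf.
move=> [a0 [Aa0 a01]] nX.
have [i u x Xx [a Aa e]||z [N [z1 fH]]] := kurosh_cyclic fG (sub_im sA hfA).
- have ex : x = u^-1 * f a * u by rewrite e !grpE.
  by rewrite ex (nX i u a Aa) -?ex // f1 !grpE.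
- by exists (f a0); split; [exists a0 | rewrite -f1 => /fI].
have [a Aa ea] : exists2 a, A a & f a = z.
  by apply: (FP_incl fH (i := true)); apply: gen_in.
exists a => // b Ab; rewrite ea; apply: (indecomposable_im fH) => //.
exists a; split=> //; last by rewrite ea; apply: gen_in.
by move=> a1; apply: z1; rewrite -ea a1.
Qed.

End Indecomposable.

(** * Grushko's theorem *)

Section LabelledPaths.
Variables (G : AbsGroup) (V : Type).
Implicit Types D : V -> G -> V -> Prop.

(** Edges may be traversed backwards with inverted label, so closed paths at [u] carry a subgroup of
    labels, the image of a fundamental group. *)
Inductive lpath D (u : V) : G -> V -> Prop :=
| lpath0 : lpath D u 1 u
| lpathS g v h w : lpath D u g v -> D v h w -> lpath D u (g * h) w
| lpathV g v h w : lpath D u g v -> D w h v -> lpath D u (g * h^-1) w.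

Lemma lpath_cat D u g v h w : lpath D u g v -> lpath D v h w -> lpath D u (g * h) w.
Proof.
move=> p; elim=> [|k x l y _ IH d|k x l y _ IH d]; rewrite ?gmulg1 // gmulA.
  exact: lpathS IH d.
exact: lpathV IH d.
Qed.

Lemma lpath_edge D u g v : D u g v -> lpath D u g v.
Proof. by move=> d; rewrite -[g]gmul1g; apply: lpathS (lpath0 _ _) d. Qed.

Lemma lpath_edgeV D u g v : D v g u -> lpath D u g^-1 v.
Proof. by move=> d; rewrite -[g^-1]gmul1g; apply: lpathV (lpath0 _ _) d. Qed.

Lemma lpath_inv D u g v : lpath D u g v -> lpath D v g^-1 u.
Proof.
elim=> [|k x l y _ IH d|k x l y _ IH d]; rewrite ?ginv1 ?ginvM; first exact: lpath0.
  exact: lpath_cat (lpath_edgeV d) IH.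
by rewrite ginvK; apply: lpath_cat (lpath_edge d) IH.
Qed.

Lemma lpath_is_sub D u : is_sub (fun g => lpath D u g u).
Proof. by split; [exact: lpath0 | move=> x y; exact: lpath_cat | move=> x; exact: lpath_inv]. Qed.

End LabelledPaths.

(** A change of gauge: the corrections [c] at the ends of successive edges telescope. *)
Lemma lpath_map (G : AbsGroup) (V V' : Type) (D : V -> G -> V -> Prop)
    (D' : V' -> G -> V' -> Prop) (t : V -> V') (c : V -> G) :
  (forall a g b, D a g b -> lpath D' (t a) (c a * g * (c b)^-1) (t b)) ->
  forall a g b, lpath D a g b -> lpath D' (t a) (c a * g * (c b)^-1) (t b).
Proof.
move=> DD' a g b; elim=> [|k x l y _ IH d|k x l y _ IH d].
- by rewrite !grpE; exact: lpath0.
- by have := lpath_cat IH (DD' _ _ _ d); rewrite !grpE.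
- by have := lpath_cat IH (lpath_inv (DD' _ _ _ d)); rewrite !grpE.
Qed.

Lemma lpath_sub (G : AbsGroup) (V : Type) (D D' : V -> G -> V -> Prop) a g b :
  (forall a g b, D a g b -> lpath D' a g b) -> lpath D a g b -> lpath D' a g b.
Proof.
move=> DD' p.
have h x k y : D x k y -> lpath D' x (1 * k * 1^-1) y by rewrite !grpE; exact: DD'.
by have := lpath_map (t := id) (c := fun _ => 1) h p; rewrite !grpE.
Qed.

Section Folding.
Variables (G : AbsGroup) (I : eqType) (A : G -> Prop) (X : I -> G -> Prop).
Hypothesis fA : FP A X.
Let sX := FP_factor fA.
Implicit Types (vs : seq nat) (E : seq (I * (nat * G * nat))).

Definition edge E i u g v : Prop := List.In (i, (u, g, v)) E.
Definition tedge E u g v : Prop := exists i, edge E i u g v.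

Record graph_wf vs E : Prop := GraphWf {
  wf_uniq : uniq vs;
  wf_base : 0%N \in vs;
  wf_edge : forall i u g v, edge E i u g v -> [/\ u \in vs, v \in vs & X i g];
  wf_conn : forall v, v \in vs -> exists g, lpath (tedge E) 0%N g v }.

(** Stallings foldedness adapted to free products: a path of a single colour with trivial label must
    close up. *)
Definition folded E := forall i u v, lpath (edge E i) u 1 v -> u = v.

Lemma edge_sub E E' a g b : (forall e, List.In e E -> List.In e E') ->
  lpath (tedge E) a g b -> lpath (tedge E') a g b.
Proof.
move=> EE'; apply: lpath_sub => x k y [i xy]; apply: lpath_edge.
by exists i; apply: EE'.
Qed.

Lemma edge_tedge E i a g b : lpath (edge E i) a g b -> lpath (tedge E) a g b.
Proof. by apply: lpath_sub => x k y xy; apply: lpath_edge; exists i. Qed.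

Lemma lpath_last E i u g v : lpath (edge E i) u g v -> u <> v ->
  exists x h, x <> v /\ (edge E i x h v \/ edge E i v h x).
Proof.
elim=> [//|k x l y _ IH d|k x l y _ IH d] uy; case: (EM (x = y)) => xy.
- by subst y; apply: IH.
- by exists x, l; split=> //; left.
- by subst y; apply: IH.
- by exists x, l; split=> //; right.
Qed.

(* Slide every edge of colour [i] at [v], except one edge from [x], over that
   edge to [x]; the paths of colour [i] survive, and the remaining edge at [v]
   is redundant once [v] is identified with [u]. *)
Lemma fold_step vs E i u v : graph_wf vs E -> lpath (edge E i) u 1 v ->
  u <> v -> v <> 0%N -> exists vs' E', [/\ graph_wf vs' E',
    forall g, lpath (tedge E) 0%N g 0%N -> lpath (tedge E') 0%N g 0%N,
    (size vs' < size vs)%N & (size E' + size vs = size E + size vs')%N].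
Proof.
move=> [uvs bvs evs cvs] puv uv v0.
have [x [h0 [xv hxv]]] := lpath_last puv uv.
have [y [h1 [yu hyu]]] := lpath_last (lpath_inv puv) (nesym uv).
have xvs : x \in vs by case: hxv => /evs [].
have vvs : v \in vs by case: hxv => /evs [].
have uvs' : u \in vs by case: hyu => /evs [].
have [e0 [h [e0E Xh e0h]]] : exists e0 h, [/\ List.In e0 E, X i h &
    e0 = (i, (x, h, v)) \/ e0 = (i, (v, h^-1, x))].
  case: hxv => hE; have [_ _ Xh] := evs _ _ _ _ hE.
    by exists (i, (x, h0, v)), h0; split=> //; left.
  exists (i, (v, h0, x)), h0^-1; split=> //; first exact: (subV (sX i)).
  by right; rewrite ginvK.
have [E1 [E2 eE]] := List.in_split _ _ e0E.
(* In colour [i] the vertex [v] slides to [x] (map [s], with correction [c]); in the other colours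
   it is identified with [u] (map [t]). *)
pose c a : G := if a == v then h else 1.
pose s a := if a == v then x else a.
pose t a := if a == v then u else a.
have cX a : X i (c a) by rewrite /c; case: eqP => // _; exact: (sub1 (sX i)).
have cv : c v = h by rewrite /c eqxx.
have sv : s v = x by rewrite /s eqxx.
have tv : t v = u by rewrite /t eqxx.
have cn a : a <> v -> c a = 1 by rewrite /c; case: eqP.
have sn a : a <> v -> s a = a by rewrite /s; case: eqP.
have tn a : a <> v -> t a = a by rewrite /t; case: eqP.
pose m (e : I * (nat * G * nat)) := let: (j, (a, g, b)) := e in
  if j == i then (j, (s a, c a * g * (c b)^-1, s b)) else (j, (t a, g, t b)).
pose E' := List.map m (List.app E1 E2).
have mE e : List.In e E -> e = e0 \/ List.In (m e) E'.
  rewrite eE => /(List.in_app_or E1) [e1|[->|e2]]; [right| by left | right];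
  by apply: List.in_map; apply: List.in_or_app; auto.
have claim1 a g b : edge E i a g b ->
    lpath (edge E' i) (s a) (c a * g * (c b)^-1) (s b).
  move=> /mE [e|]; last by rewrite /m eqxx; apply: lpath_edge.
  case: e0h; rewrite -e => -[-> -> ->]; rewrite cv sv cn // sn // !grpE; exact: lpath0.
(* The image of the trivially labelled path from [u] to [v]: it replaces the deleted edge once [v]
   has become [u]. *)
have ux : lpath (edge E' i) u h^-1 x.
  by have := lpath_map claim1 puv; rewrite sv cv sn // cn // !grpE.
have ts a : lpath (edge E' i) (t a) (c a)^-1 (s a).
  have [->|/eqP av] := eqVneq a v; first by rewrite tv cv sv.
  by rewrite tn // cn // sn // ginv1; exact: lpath0.
have claim3 a g b : edge E i a g b -> lpath (edge E' i) (t a) g (t b).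
  move=> /claim1 p.
  by have := lpath_cat (lpath_cat (ts a) p) (lpath_inv (ts b)); rewrite !grpE.
have claim4 a g b : lpath (tedge E) a g b -> lpath (tedge E') (t a) g (t b).
  move=> p.
  suff D j k l : tedge E j k l -> lpath (tedge E') (t j) (1 * k * 1^-1) (t l).
    by have := lpath_map D p; rewrite !grpE.
  rewrite !grpE => -[i' e]; have [ii|ii] := eqVneq i' i.
    by subst i'; apply: edge_tedge (claim3 _ _ _ e).
  apply: lpath_edge; exists i'; have [e'|] := mE _ e.
    by case: e0h; rewrite -e' => -[i'i]; rewrite i'i eqxx in ii.
  by rewrite /m (negPf ii).
have t0 : t 0%N = 0%N by rewrite tn //; apply: nesym.
have E'wf j a g b : edge E' j a g b -> [/\ a \in vs, b \in vs & X j g] /\ (a <> v /\ b <> v).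
  move=> /List.in_map_iff [[j' [[a' g'] b']] [me eE']].
  have {}eE' : List.In (j', (a', g', b')) E.
    by rewrite eE; apply: List.in_or_app; have [] := List.in_app_or _ _ _ eE'; [left|right; right].
  have [av bv Xg] := evs _ _ _ _ eE'.
  move: me; rewrite /m; have [ji|ji] := eqVneq j' i => -[<- <- <- <-].
    subst j'; split.
      split; [by rewrite /s; case: eqP | by rewrite /s; case: eqP |].
      apply: (subM (sX i)); first exact: (subM (sX i)).
      exact: (subV (sX i)).
    by split; rewrite /s; case: eqP.
  by split; split=> //; rewrite /t; case: eqP.
exists (rem v vs), E'; split.
- split=> [||j a g b /E'wf [[av bv Xg] [/eqP a_v /eqP b_v]]|w].
  + exact: rem_uniq.
  + by rewrite mem_rem_uniq // inE bvs andbT eq_sym; apply/eqP.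
  + by split=> //; rewrite mem_rem_uniq // inE ?a_v ?b_v.
  rewrite mem_rem_uniq // inE => /andP [/eqP wv /cvs [g /claim4]].
  by rewrite t0 tn //; exists g.
- by move=> g /claim4; rewrite t0.
- by rewrite size_rem //; case: (vs) vvs.
(* One vertex and one edge are lost, so the Euler characteristic is preserved; this is what bounds
   the rank in the end. *)
have szcat (T : Type) (k l : list T) : size (List.app k l) = (size k + size l)%N.
  exact: List.length_app.
have szmap (T U : Type) (f : T -> U) l : size (List.map f l) = size l.
  exact: List.length_map.
rewrite size_rem // /E' szmap eE !szcat /=.
by move: vvs; case: (vs) => //= *; lia.
Qed.

Lemma fold_exists vs E : graph_wf vs E -> exists vs' E', [/\ graph_wf vs' E',
    forall g, lpath (tedge E) 0%N g 0%N -> lpath (tedge E') 0%N g 0%N,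
    folded E' & (size E' + size vs = size E + size vs')%N].
Proof.
have [n] := ubnP (size vs); elim: n vs E => // n IH vs E; rewrite ltnS => sn wf.
case: (EM (folded E)) => [|nf]; first by exists vs, E.
have [i [u [v [puv uv]]]] : exists i u v, lpath (edge E i) u 1 v /\ u <> v.
  apply: contrapT => nex; apply: nf => i u v p; apply: contrapT => uv.
  by apply: nex; exists i, u, v.
(* The base vertex must survive; the ends are distinct and interchangeable, so the one removed can
   be taken different from 0. *)
wlog v0 : u v puv uv / v <> 0%N.
  move=> W; case: (EM (v = 0%N)) => v0; last exact: (W u v).
  apply: (W v u); [|exact: nesym|by rewrite -v0].
  by rewrite -ginv1; apply: lpath_inv.
have [vs1 [E1 [wf1 p1 s1 z1]]] := fold_step wf puv uv v0.
have [|vs' [E' [wf' p' f' z']]] := IH vs1 E1 _ wf1; first exact: leq_trans sn.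
by exists vs', E'; split=> // [g /p1 /p' //|]; lia.
Qed.

Lemma lpath_label vs E i u g v : graph_wf vs E -> lpath (edge E i) u g v -> X i g.
Proof.
move=> wf; elim=> [|k x l y _ Xk d|k x l y _ Xk d].
- exact: (sub1 (sX i)).
- by apply: (subM (sX i)) => //; have [_ _] := wf_edge wf d.
- by apply: (subM (sX i)) => //; apply: (subV (sX i)); have [_ _] := wf_edge wf d.
Qed.

Fixpoint wpath E u (w : seq (I * G)) v : Prop :=
  if w is (i, y) :: w' then exists t, lpath (edge E i) u y t /\ wpath E t w' v
  else u = v.

(** Foldedness enters where the merged syllable cancels: its path then has trivial label, so
    dropping it does not move the start. *)
Lemma wpath_push vs E i y w u v t : graph_wf vs E -> folded E ->
  lpath (edge E i) u y v -> reduced X w -> wpath E v w t -> wpath E u (push i y w) t.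
Proof.
move=> wf fE p /(cons1P sX i) [z [w' [Xz fw rw ->]]] pw; rewrite push_cons1 //.
have [s [ps pw']] : exists s, lpath (edge E i) v z s /\ wpath E s w' t.
  move: pw; rewrite /cons1; case: asboolP => [->|_ //] pw.
  by exists v; split=> //; exact: lpath0.
have ps' := lpath_cat p ps.
rewrite /cons1; case: asboolP => [e|_]; last by exists s.
by rewrite e in ps'; rewrite (fE _ _ _ ps').
Qed.

Lemma lpath_wpath vs E u g v : graph_wf vs E -> folded E -> lpath (tedge E) u g v ->
  exists w, [/\ reduced X w, eval w = g & wpath E u w v].
Proof.
move=> wf fE p.
(* Paths grow at their end, so the induction hands the last edge over to a continuation [w0]. *)
suff W w0 t : reduced X w0 -> wpath E v w0 t ->
    exists w, [/\ reduced X w, eval w = g * eval w0 & wpath E u w t].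
  by have [//|//|w [rw ew pw]] := W [::] v; exists w; rewrite ew gmulg1.
move=> r0 p0.
elim: p w0 t r0 p0 => [|k x l y _ IH [i d]|k x l y _ IH [i d]] w0 t r0 p0.
- by exists w0; rewrite gmul1g.
- have pd := lpath_edge d; have Xl := lpath_label wf pd.
  have [|//|w [rw ew pw]] := IH (push i l w0) t; first exact: reduced_push.
    exact: (wpath_push wf fE pd).
  by exists w; split=> //; rewrite ew eval_push gmulA.
- have pd := lpath_edgeV d; have Xl := lpath_label wf pd.
  have [|//|w [rw ew pw]] := IH (push i l^-1 w0) t; first exact: reduced_push.
    exact: (wpath_push wf fE pd).
  by exists w; split=> //; rewrite ew eval_push gmulA.
Qed.

(** An element [h] of [X i] labels a closed path at 0, which by uniqueness of normal forms can be
    taken of colour [i]. A path of colour [i] and label [h] from 0 to [w] then gives a trivially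
    labelled one, and folding yields [w] = 0. *)
Lemma folded_rose vs E : graph_wf vs E -> folded E ->
  (forall a, A a -> lpath (tedge E) 0%N a 0%N) -> size vs = 1%N.
Proof.
move=> wf fE surj.
have step i h w : lpath (edge E i) 0%N h w -> w = 0%N.
  move=> p; have Xh := lpath_label wf p.
  case: (EM (h = 1)) => [h1|h1]; first by rewrite h1 in p; rewrite -(fE _ _ _ p).
  have [w' [rw ew pw]] := lpath_wpath wf fE (surj _ (FP_incl fA Xh)).
  have ew' : w' = [:: (i, h)].
    apply: (reduced_uniq fA) => //.
    by rewrite ew /= gmulg1.
  move: pw; rewrite ew' /= => -[t [p' t0]].
  by have := lpath_cat (lpath_inv p') p; rewrite gmulVg => /fE <-.
have all0 g v : lpath (tedge E) 0%N g v -> v = 0%N.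
  elim=> [//|k x l y _ -> [i d]|k x l y _ -> [i d]].
    exact: step (lpath_edge d).
  exact: step (lpath_edgeV d).
have [uvs bvs _ cvs] := wf.
have vs0 : {subset vs <= [:: 0%N]} by move=> v /cvs [g /all0 ->].
by apply/eqP; rewrite eqn_leq (uniq_leq_size uvs vs0) /=; case: (vs) bvs.
Qed.

(** Attaches an arc with one edge per syllable, whose last edge returns to the base vertex; the
    inner vertices are fresh, numbered above the maximum. *)
Lemma add_word vs E u w : graph_wf vs E -> valid X w -> w <> [::] -> u \in vs ->
  exists vs' E', [/\ graph_wf vs' E', forall e, List.In e E -> List.In e E',
    lpath (tedge E') u (eval w) 0%N & (size E' + size vs = (size E + size vs').+1)%N].
Proof.
elim: w vs E u => [//|[i y] w IH] vs E u wf /= [[Xy _] vw] _ uvs.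
have [uniqvs bvs evs cvs] := wf.
case: w IH vw => [|s w] IH vw.
  exists vs, ((i, (u, y, 0%N)) :: E); split=> //.
  - split=> // [j a g b|v /cvs [g p]]; first by move=> [[<- <- <- <-] //|/evs].
    by exists g; apply: edge_sub p => e; right.
  - by move=> e; right.
  - by rewrite gmulg1; apply: lpath_edge; exists i; left.
pose t := (\max_(v <- vs) v).+1.
have vt v : v \in vs -> v != t.
  move=> vvs; have : (v <= \max_(v <- vs) v)%N by apply: leq_bigmax_seq.
  by rewrite -ltnS => /ltn_eqF ->.
pose E1 := (i, (u, y, t)) :: E.
have EE1 e : List.In e E -> List.In e E1 by right.
have eut : tedge E1 u y t by exists i; left.
have [||||vs' [E' [wf' sE' p' z']]] := IH (t :: vs) E1 t; last first.
- exists vs', E'; split=> // [e /EE1 /sE' //||]; last by rewrite /= in z'; lia.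
  apply: lpath_cat p'; apply: lpath_edge; have [j ej] := eut.
  by exists j; apply: sE'.
- by rewrite inE eqxx.
- by [].
- by [].
split=> [||j a g b|v].
- by rewrite /= uniqvs andbT; apply/negP => /vt; rewrite eqxx.
- by rewrite inE bvs orbT.
- move=> [[<- <- <- <-]|/evs [av bv Xg]]; first by rewrite !inE uvs eqxx orbT.
  by rewrite !inE av bv !orbT.
rewrite inE => /orP [/eqP ->|/cvs [g p]]; last first.
  by exists g; apply: edge_sub p.
have [g p] := cvs _ uvs; exists (g * y); apply: lpathS eut.
exact: edge_sub p.
Qed.

(** Edges minus vertices starts at -1, and every generator raises it by at most one. *)
Lemma graph_of_list (l : list G) : (forall a, List.In a l -> A a) ->
  exists vs E, [/\ graph_wf vs E, forall a, List.In a l -> lpath (tedge E) 0%N a 0%N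
    & (size E < size l + size vs)%N].
Proof.
elim: l => [_|a l IH lA].
  exists [:: 0%N], [::]; split=> //; split=> // v; rewrite inE => /eqP ->.
  by exists 1; exact: lpath0.
have [|vs [E [wf p z]]] := IH; first by move=> b bl; apply: lA; right.
have [rw ew] := nfP fA (lA a (or_introl erefl)).
case: (EM (nf X a = [::])) => [nf0|nf0].
  exists vs, E; split=> // [b [<-|/p //]|]; last by rewrite /=; lia.
  by rewrite -ew nf0; exact: lpath0.
have [vs' [E' [wf' sE p' z']]] := add_word wf rw.1 nf0 (wf_base wf).
exists vs', E'; split=> // [b [<-|/p pb]|]; first by rewrite -ew.
  exact: edge_sub pb.
by rewrite /=; lia.
Qed.

(** The retraction onto [X i] kills the labels of other colours and fixes those of colour [i]; apply
    it to a closed path labelled by an element of [X i]. *)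
Lemma rose_generate vs E i : graph_wf vs E ->
  (forall a, A a -> lpath (tedge E) 0%N a 0%N) ->
  forall x, X i x <-> gen (fun y => List.In y [seq e.2.1.2 | e <- E & e.1 == i]) x.
Proof.
move=> wf surj x.
have inl j u g v : edge E j u g v -> j = i -> List.In g [seq e.2.1.2 | e <- E & e.1 == i].
  rewrite /edge => + ji; elim: (E) => //= e E' IH [->|/IH h] /=.
    by rewrite ji eqxx; left.
  by case: ifP => // _; right.
have [r [hr rX rid r1]] := FP_retract i fA.
split=> [Xx|].
  rewrite -(rid x Xx); have : A x by apply: (FP_incl fA Xx).
  move=> /surj p.
  suff [] : A x /\ gen (fun y => List.In y [seq e.2.1.2 | e <- E & e.1 == i]) (r x) by [].
  have sA := FP_sub fA; have sP := sub_preim sA hr (gen_is_sub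
    (fun y => List.In y [seq e.2.1.2 | e <- E & e.1 == i])).
  have edgeP u g v : tedge E u g v ->
      A g /\ gen (fun y => List.In y [seq e.2.1.2 | e <- E & e.1 == i]) (r g).
    move=> [j d]; have [_ _ Xg] := wf_edge wf d; split; first exact: (FP_incl fA Xg).
    have [ji|/eqP ji] := eqVneq j i; last by rewrite (r1 j) //; exact: gen_one.
    by subst j; rewrite rid //; apply: gen_in; apply: inl d _.
  elim: p => [|k u l v _ IH /edgeP d|k u l v _ IH /edgeP d].
  - exact: (sub1 sP).
  - exact: (subM sP).
  - by apply: (subM sP) => //; apply: (subV sP).
apply: (gen_min (sX i)) => {}x /List.in_map_iff [[j [[u g] v]] [<-]].
move=> /List.filter_In /= [d /eqP ji]; have [_ _] := wf_edge wf d.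
by rewrite ji.
Qed.

End Folding.

(** Folding ends with one vertex, and the preserved Euler characteristic leaves at most [size l]
    edges; sorting their labels by colour gives the two lists. *)
Lemma grushko (G : AbsGroup) (A B C : G -> Prop) (l : list G) :
  FP2 A B C -> (forall x, A x <-> gen (fun y => List.In y l) x) ->
  exists lb lc, [/\ forall x, B x <-> gen (fun y => List.In y lb) x,
    forall x, C x <-> gen (fun y => List.In y lc) x & (size lb + size lc <= size l)%N].
Proof.
move=> fA Al; have lA a : List.In a l -> A a by move=> al; apply/Al; apply: gen_in.
have [vs [E [wf p z]]] := graph_of_list fA lA.
have [vs' [E' [wf' p' fE' z']]] := fold_exists fA wf.
have surj a : A a -> lpath (tedge E') 0%N a 0%N.
  move=> /Al; apply: (gen_min (lpath_is_sub _ _)) => b /p; exact: p'.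
have vs1 := folded_rose fA wf' fE' surj.
exists [seq e.2.1.2 | e <- E' & e.1 == true], [seq e.2.1.2 | e <- E' & e.1 == false]; split.
- exact: (rose_generate fA true wf' surj).
- exact: (rose_generate fA false wf' surj).
rewrite !size_map !size_filter.
have -> : count (fun e : bool * (nat * G * nat) => e.1 == false) E' =
          count (predC (fun e => e.1 == true)) E'.
  by apply: eq_count => -[[] e].
by rewrite count_predC; lia.
Qed.

(** Each nontrivial factor takes at least one generator, so both sides of a proper splitting need
    fewer than [A]. *)
Lemma indecomposable_factors (G : AbsGroup) (A : G -> Prop) : fg_subgroup A ->
  exists (J : finType) (Y : J -> G -> Prop),
    FP A Y /\ forall j, indecomposable (Y j).
Proof.
move=> [l]; have [n] := ubnP (size l); elim: n A l => // n IH A l; rewrite ltnS => ln Al.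
have sA : is_sub A by apply: fg_sub; exists l.
case: (EM (indecomposable A)) => [iA|niA].
  by exists unit, (fun _ => A); split=> //; exact: FP_unit.
have [B [C [fA nB nC]]] : exists B C, [/\ FP2 A B C,
    ~ (forall x, B x -> x = 1) & ~ (forall x, C x -> x = 1)].
  apply: contrapT => nex; apply: niA => B C fA; apply: contrapT => /not_orP [nB nC].
  by apply: nex; exists B, C.
have [lb [lc [Bl Cl z]]] := grushko fA Al.
have gt0 D ld : (forall x : G, D x <-> gen (fun y => List.In y ld) x) ->
    ~ (forall x, D x -> x = 1) -> (0 < size ld)%N.
  case: ld => // Dl nD; case: nD => x /Dl.
  by apply: (gen_min (@sub_triv G)) => y [].
have b0 := gt0 _ _ Bl nB; have c0 := gt0 _ _ Cl nC.
have [|JB [YB [fB iB]]] := IH B lb _ Bl; first by lia.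
have [|JC [YC [fC iC]]] := IH C lc _ Cl; first by lia.
pose J b : finType := if b then JB else JC.
pose Y b : J b -> G -> Prop := if b return J b -> G -> Prop then YB else YC.
exists {b : bool & J b}, (fun s => Y (tag s) (tagged s)); split.
  by apply: (FP_trans fA) => -[].
by case=> -[] j /=; [exact: iB | exact: iC].
Qed.

(** * The Goldstein-Turner flow *)

Section FiniteGraphs.
Variables (G : AbsGroup) (V : Type).
Implicit Types (E : list (V * G * V)) (R : V -> G -> V -> Prop).

Definition ledge E u g v := List.In (u, g, v) E.

(** Chosen paths [t] replace a spanning tree. The path [t v0] need not be trivial, so it joins the
    generators. *)
Lemma lpath_fg E v0 : fg_subgroup (fun g => lpath (ledge E) v0 g v0).
Proof.
have /choice [t tP] v : exists h, (exists g, lpath (ledge E) v0 g v) ->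
    lpath (ledge E) v0 h v.
  by case: (EM (exists g, lpath (ledge E) v0 g v)) => [[g p]|n]; [exists g | exists 1].
pose c (e : V * G * V) := let: (u, g, v) := e in
  if pselect (exists h, lpath (ledge E) v0 h u) then t u * g * (t v)^-1 else 1.
pose S y := List.In y (t v0 :: List.map c E).
have edgeS u g v : ledge E u g v -> (exists h, lpath (ledge E) v0 h u) ->
    S (t u * g * (t v)^-1).
  move=> e r; right; have -> : t u * g * (t v)^-1 = c (u, g, v).
    by rewrite /c; case: pselect.
  exact: List.in_map.
exists (t v0 :: List.map c E) => g; split=> [p|].
  suff W v h : lpath (ledge E) v0 h v -> gen S (t v0 * h * (t v)^-1).
    have St : gen S (t v0) by apply: gen_in; left.
    have := gen_mul (gen_mul (gen_inv St) (W _ _ p)) St.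
    by rewrite !grpE.
  elim=> [|k x l y q IH e|k x l y q IH e].
  - by rewrite !grpE; exact: gen_one.
  - have := gen_mul IH (gen_in (edgeS _ _ _ e (ex_intro _ _ q))).
    by rewrite !grpE.
  - have r : exists h, lpath (ledge E) v0 h y.
      by exists (k * l^-1); apply: lpathV q e.
    have := gen_mul IH (gen_inv (gen_in (edgeS _ _ _ e r))).
    by rewrite !grpE.
apply: (gen_min (lpath_is_sub _ _)) => y [<-|].
  by apply: tP; exists 1; exact: lpath0.
move=> /List.in_map_iff [[[u k] v] [<- e]]; rewrite /c.
case: pselect => r; last exact: lpath0.
have pv := lpathS (tP _ r) e.
have := lpath_cat pv (lpath_inv (tP v (ex_intro _ _ pv))).
by [].
Qed.

Variable act : G -> V -> V.
Hypotheses (act1 : forall v, act 1 v = v)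
           (actM : forall x y v, act (x * y) v = act x (act y v)).

(** Labels act from target to source; with this convention left actions match the multiplication of
    labels along paths. *)
Definition arrows E := forall u g v, ledge E u g v -> act g v = u.

Lemma actK x v : act x^-1 (act x v) = v.
Proof. by rewrite -actM grpE act1. Qed.

Lemma lpath_act E u g v : arrows E -> lpath (ledge E) u g v -> act g v = u.
Proof.
move=> aE; elim=> [|k x l y _ IH e|k x l y _ IH e]; first exact: act1.
  by rewrite actM (aE _ _ _ e).
by rewrite actM -(aE _ _ _ e) actK.
Qed.

Lemma ledge_sub E E' u g v : (forall e, List.In e E -> List.In e E') ->
  lpath (ledge E) u g v -> lpath (ledge E') u g v.
Proof. by move=> EE'; apply: lpath_sub => x k y xy; apply: lpath_edge; apply: EE'. Qed.

(** A possibly infinite family of arrows, all composed from finitely many. *)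
Definition fin_arrows R := exists E, arrows E /\
  forall u g v, R u g v -> lpath (ledge E) u g v.

Lemma fin_arrows_sub R R' : (forall u g v, R u g v -> R' u g v) ->
  fin_arrows R' -> fin_arrows R.
Proof. by move=> RR' [E [aE EP]]; exists E; split=> // u g v /RR' /EP. Qed.

Lemma fin_arrowsU R R' : fin_arrows R -> fin_arrows R' ->
  fin_arrows (fun u g v => R u g v \/ R' u g v).
Proof.
move=> [E [aE EP]] [E' [aE' EP']]; exists (List.app E E'); split.
  by move=> u g v /(List.in_app_or E) [/aE|/aE'].
move=> u g v [/EP|/EP']; apply: ledge_sub => e eE; apply: List.in_or_app; tauto.
Qed.

Lemma fin_arrows_list (T : Type) (l : list T) (R : T -> V -> G -> V -> Prop) :
  (forall x, List.In x l -> fin_arrows (R x)) ->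
  fin_arrows (fun u g v => exists x, List.In x l /\ R x u g v).
Proof.
elim: l => [_|x l IH lR].
  by exists nil; split=> [u g v []|u g v [x []]].
have := fin_arrowsU (lR x (or_introl erefl)) (IH (fun y yl => lR y (or_intror yl))).
apply: fin_arrows_sub => u g v [y [[->|yl] Ry]]; first by left.
by right; exists y.
Qed.

Lemma fin_arrows1 u g v : act g v = u ->
  fin_arrows (fun u' g' v' => [/\ u' = u, g' = g & v' = v]).
Proof.
move=> e; exists [:: (u, g, v)]; split=> [u' g' v' [[<- <- <-]|[]] //|u' g' v' [-> -> ->]].
by apply: lpath_edge; left.
Qed.

Lemma fin_arrows_loop (B : G -> Prop) v : fg_subgroup B ->
  (forall g, B g -> act g v = v) ->
  fin_arrows (fun u' g' v' => [/\ u' = v, B g' & v' = v]).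
Proof.
move=> [l lB] Bv; exists (List.map (fun g => (v, g, v)) l); split.
  move=> u g w /List.in_map_iff [h [[<- <- <-] hl]]; apply: Bv.
  by apply/lB; apply: gen_in.
move=> _ g _ [-> /lB Bg ->]; apply: (gen_min (lpath_is_sub _ _) _ Bg) => h hl.
apply: lpath_edge; exact: (List.in_map (fun g => (v, g, v))).
Qed.

End FiniteGraphs.

(* Every vertex [u] is pushed along the orbit of
   the factor [ch u] to a representative of that orbit. This defines a flow with
   one outgoing edge per vertex; by [bad_finite] only finitely many
   further edges and loop groups matter, so a component of the resulting
   graph of groups has finitely generated fundamental group. *)
Section Flow.
Variables (G : AbsGroup) (V : Type) (act : G -> V -> V).
Hypotheses (act1 : forall v, act 1 v = v)
           (actM : forall x y v, act (x * y) v = act x (act y v)).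
Variables (J : finType) (H : J -> G -> Prop).
Hypotheses (sH : forall j, is_sub (H j))
           (genH : forall x, gen (fun y => exists j, H j y) x).
Variables (ch : V -> option J) (W : list V).
Hypothesis bad_finite : forall j u a, H j a -> a <> 1 -> ch u <> Some j ->
  ch (act a u) <> Some j -> List.In u W \/ List.In (act a u) W.
Hypothesis stab_fg : forall j u, fg_subgroup (fun a => H j a /\ act a u = u).
Variable v0 : V.

Definition forb j u v := exists a, H j a /\ act a u = v.

Lemma forb_refl j u : forb j u u.
Proof. by exists 1; split; [exact: (sub1 (sH j)) | exact: act1]. Qed.

Lemma forb_sym j u v : forb j u v -> forb j v u.
Proof.
move=> [a [Ha <-]]; exists a^-1; rewrite (actK act1 actM).
by split=> //; exact: (subV (sH j)).
Qed.

Lemma forb_trans j u v w : forb j u v -> forb j v w -> forb j u w.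
Proof.
move=> [a [Ha <-]] [b [Hb <-]]; exists (b * a); rewrite actM.
by split=> //; exact: (subM (sH j)).
Qed.

(** Minimal rank makes an orbit representative avoid flowing along [j] when possible, and then avoid
    [W] when possible. *)
Definition rank j v : nat :=
  (if ch v == Some j then 2 else if `[< List.In v W >] then 1 else 0)%N.

Definition frep j u : V :=
  eps v0 (fun v => forb j u v /\ forall v', forb j u v' -> (rank j v <= rank j v')%N).

Lemma frepP j u : forb j u (frep j u) /\
  forall v, forb j u v -> (rank j (frep j u) <= rank j v)%N.
Proof. exact: (epsP v0 (exists_min (rank j) (ex_intro (forb j u) u (forb_refl j u)))). Qed.

Lemma frep_eq j u v : forb j u v -> frep j v = frep j u.
Proof.
move=> uv; have vu := forb_sym uv; apply: eps_ext => w.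
split=> -[vw h]; split=> [|w' ow].
- exact: forb_trans uv vw.
- by apply: h; apply: forb_trans vu ow.
- exact: forb_trans vu vw.
- by apply: h; apply: forb_trans uv ow.
Qed.

(** The value 1 at representatives keeps the label trivial at fixed points of the flow. *)
Definition fstep j u : G :=
  if pselect (frep j u = u) then 1 else eps 1 (fun a => H j a /\ act a u = frep j u).

Lemma fstepP j u : H j (fstep j u) /\ act (fstep j u) u = frep j u.
Proof.
rewrite /fstep; case: pselect => [e|ne] /=.
  by rewrite act1 e; split=> //; exact: (sub1 (sH j)).
exact: (epsP 1 (frepP j u).1).
Qed.

Lemma fstep1 j u : frep j u = u -> fstep j u = 1.
Proof. by rewrite /fstep; case: pselect. Qed.

(** The representative has rank at most that of [u], hence at most 1, and does not flow along [j].
    So [bad_finite] puts one of the two in [W]; if it is the representative, minimality of its rank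
    puts [u] there too. *)
Lemma frep_W j u : ch u <> Some j -> frep j u <> u -> List.In u W.
Proof.
move=> cu ru; have [Ha ea] := fstepP j u; have [_ /(_ u (forb_refl j u)) rk] := frepP j u.
have rku : (rank j u <= 1)%N by rewrite /rank; case: eqP => // _; case: asboolP.
have cr : ch (frep j u) <> Some j.
  by move=> e; move: (leq_trans rk rku); rewrite /rank e eqxx.
have [|||//|] := @bad_finite j u (fstep j u) Ha; rewrite ?ea //.
  by move=> e; apply: ru; rewrite -ea e act1.
move=> rW; move: rk; rewrite /rank.
case: eqP => // _; case: (asboolP (List.In (frep j u) W)) => // _.
by case: eqP => // _; case: asboolP.
Qed.

Definition next u := if ch u is Some j then frep j u else u.
Definition step u : G := if ch u is Some j then fstep j u else 1.

Lemma stepP u : act (step u) u = next u.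
Proof. by rewrite /step /next; case: (ch u) => [j|]; [case: (fstepP j u) | exact: act1]. Qed.

Lemma step1 u : next u = u -> step u = 1.
Proof. by rewrite /step /next; case: (ch u) => // j; exact: fstep1. Qed.

Fixpoint steps k u : G := if k is k'.+1 then steps k' (next u) * step u else 1.
Local Notation flow k u := (iter k next u).

Lemma stepsD k m u : steps (k + m) u = steps m (flow k u) * steps k u.
Proof.
elim: k u => [|k IH] u; first by rewrite grpE.
by rewrite addSn [LHS]/= IH -iterSr [steps k.+1 u]/= gmulA.
Qed.

Lemma stepsP k u : act (steps k u) u = flow k u.
Proof. by elim: k u => [|k IH] u; rewrite ?act1 // [steps _ _]/= actM stepP IH -iterSr. Qed.

Lemma flow_fixed k x : next x = x -> flow k x = x /\ steps k x = 1.
Proof.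
move=> nx; elim: k => [//|k [IH1 IH2]]; split; first by rewrite iterS IH1.
by rewrite /= nx IH2 (step1 nx) grpE.
Qed.

(** A factor leaves a loop group at [x] only if [x] flows along it and is its own orbit
    representative. *)
Definition floop x a := a = 1 \/ exists j, [/\ ch x = Some j, next x = x, H j a & act a x = x].

Lemma floop_sub x : is_sub (floop x).
Proof.
split=> [|a b [->|[j [cx nx Ha fa]]]|a [->|[j [cx nx Ha fa]]]].
- by left.
- by rewrite gmul1g.
- move=> [->|[j' [cx' _ Hb fb]]]; first by rewrite gmulg1; right; exists j.
  right; exists j; split=> //; last by rewrite actM fb.
  by apply: (subM (sH j)) => //; move: cx'; rewrite cx => -[->].
- by rewrite ginv1; left.
- right; exists j; split=> //; first exact: (subV (sH j)).
  by rewrite -{1}fa (actK act1 actM).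
Qed.

Lemma floop_act x a : floop x a -> act a x = x.
Proof. by case=> [->|[j []]]. Qed.

Lemma floop_fixed x a : floop x a -> a <> 1 -> next x = x.
Proof. by case=> [//|[j []]]. Qed.

Lemma floop_fg x : next x = x -> fg_subgroup (floop x).
Proof.
case cx : (ch x) => [j|] nx; last first.
  by apply: (fg_ext _ (@fg_triv G)) => a; split=> [->|[//|[j []]]]; [left | rewrite cx].
apply: (fg_ext _ (stab_fg j x)) => a; split=> [[Ha fa]|[->|[j' []]]].
- by right; exists j.
- by rewrite act1; split=> //; exact: (sub1 (sH j)).
- by rewrite cx => -[->].
Qed.

(** With one outgoing edge per vertex, two connected vertices have flow lines that merge; a zigzag
    reduces to running forward from [s], a loop, and running back to [s']. *)
Definition fconn s p s' := exists k l a,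
  [/\ flow k s = flow l s', floop (flow k s) a & p = (steps l s')^-1 * a * steps k s].

Lemma fconn_refl s : fconn s 1 s.
Proof. by exists 0%N, 0%N, 1; split=> //; [left | rewrite !grpE]. Qed.

Lemma fconn_fwd s p u : fconn s p u -> fconn s (step u * p) (next u).
Proof.
move=> [k [[|l] [a [e La ->]]]]; last first.
  exists k, l, a; split=> //; first by rewrite e iterSr.
  by rewrite [steps l.+1 u]/= !grpE.
rewrite /= in e *; case: (EM (a = 1)) => [->|a1].
  exists k.+1, 0%N, 1; split=> //; [by rewrite iterS e | by left |].
  by rewrite -addn1 stepsD e /= !grpE.
have nu : next u = u by rewrite -e; exact: (floop_fixed La).
by exists k, 0%N, a; rewrite (step1 nu) nu; split=> //; rewrite !grpE.
Qed.

Lemma fconn_bwd s p u : fconn s p (next u) -> fconn s ((step u)^-1 * p) u.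
Proof.
move=> [k [l [a [e La ->]]]]; exists k, l.+1, a; split=> //; first by rewrite e -iterSr.
by rewrite [steps l.+1 u]/= !grpE.
Qed.

Lemma fconn_loop s p u c : floop u c -> fconn s p u -> fconn s (c * p) u.
Proof.
move=> Lc; case: (EM (c = 1)) => [->|c1]; first by rewrite gmul1g.
have nu := floop_fixed Lc c1; move=> [k [l [a [e La ->]]]].
have [fl sl] := flow_fixed l nu; rewrite fl in e.
exists k, 0%N, (c * a); split=> //; last by rewrite sl /= !grpE.
by rewrite e in La *; apply: (subM (floop_sub u)).
Qed.

Lemma fconn_fwdn s p u k : fconn s p u -> fconn s (steps k u * p) (flow k u).
Proof.
elim: k u p => [|k IH] u p h; first by rewrite gmul1g.
by rewrite iterSr [steps _ _]/= gmulAr; apply: IH; apply: fconn_fwd.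
Qed.

Lemma fconn_bwdn s p u k : fconn s p (flow k u) -> fconn s ((steps k u)^-1 * p) u.
Proof.
elim: k u p => [|k IH] u p h; first by rewrite !grpE.
rewrite [steps _ _]/= ginvM gmulAr; apply: fconn_bwd; apply: IH.
by rewrite -iterSr.
Qed.

Lemma fconn_trans s p s' q s'' : fconn s p s' -> fconn s' q s'' -> fconn s (q * p) s''.
Proof.
move=> sp [k [l [a [e La ->]]]]; rewrite !gmulAr; apply: fconn_bwdn; rewrite -e.
by apply: fconn_loop => //; apply: fconn_fwdn.
Qed.

Lemma fconn_inv s p s' : fconn s p s' -> fconn s' p^-1 s.
Proof.
move=> [k [l [a [e La ->]]]]; exists l, k, a^-1; rewrite -e !grpE.
by split=> //; exact: (subV (floop_sub _)).
Qed.

Lemma fconn_act s p s' : fconn s p s' -> act p s = s'.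
Proof.
move=> [k [l [a [e La ->]]]]; rewrite !actM stepsP (floop_act La) e -stepsP.
exact: (actK act1 actM).
Qed.

Lemma steps_shift k d m s : flow (k + d) s = flow k s ->
  (steps k s)^-1 * steps (k + d) s = (steps (k + m) s)^-1 * steps (k + d + m) s.
Proof. by move=> e; rewrite (stepsD k m) (stepsD (k + d) m) e !grpE. Qed.

Lemma flow_shift k d m s : flow (k + d) s = flow k s -> flow (k + m + d) s = flow (k + m) s.
Proof.
by move=> e; rewrite addnAC addnC iterD e -iterD addnC.
Qed.

(** Three cases: the flow line of [s] stops, and the group is a conjugate of a loop group; it
    becomes periodic, and the group is generated by the label of the shortest cycle; or it never
    repeats, and the group is trivial. *)
Lemma fconn_fg s : fg_subgroup (fun p => fconn s p s).
Proof.
case: (EM (exists K, next (flow K s) = flow K s)) => [[K nx]|nf].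
  set x := flow K s in nx.
  have sc : homOn (floop x) (fun a => (steps K s)^-1 * a * steps K s).
    by move=> a b _ _; rewrite !grpE.
  apply: (fg_ext _ (fg_im (floop_sub x) sc (floop_fg nx))) => p.
  split=> [[a La <-]|[k [l [a [e La ->]]]]]; first by exists K, K, a.
  have stepsK m : steps (m + K) s = steps K s.
    by rewrite addnC stepsD -/x (flow_fixed m nx).2 gmul1g.
  case: (EM (a = 1)) => [->|a1].
    exists 1; first by left.
    have : steps (k + K) s = steps (l + K) s by rewrite !stepsK.
    by rewrite !stepsD e => /gmulI ->; rewrite !grpE.
  have ny := floop_fixed La a1.
  have sk m : flow m s = flow k s -> steps m s = steps K s.
    move=> em; rewrite -(stepsK m) stepsD em (flow_fixed K ny).2; by rewrite gmul1g.
  exists a; last by rewrite (sk k) // (sk l).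
  suff -> : x = flow k s by [].
  rewrite -(flow_fixed K ny).1 -iterD (addnC K) -[RHS]/(flow _ _).
  by rewrite iterD -/x (flow_fixed k nx).1.
have L1 k a : floop (flow k s) a -> a = 1.
  move=> La; apply: contrapT => a1; apply: nf; exists k; exact: floop_fixed La a1.
case: (EM (exists T, (0 < T)%N /\ exists k, flow (k + T) s = flow k s)) => [per|nper].
  have [T [[T0 [k0 eT]] Tmin]] := exists_min id per.
  pose c := (steps k0 s)^-1 * steps (k0 + T) s.
  have Mc : fconn s c s.
    by exists (k0 + T)%N, k0, 1; split=> //; [left | rewrite /c !grpE].
  have cycP d k : flow (k + d) s = flow k s ->
      cyc c ((steps k s)^-1 * steps (k + d) s).
    have [n] := ubnP d; elim: n d k => // n IH d k; rewrite ltnS => dn e.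
    case: (posnP d) => [->|d0]; first by rewrite addn0 gmulVg; exact: gen_one.
    have Td : (T <= d)%N by apply: Tmin; split=> //; exists k.
    rewrite (steps_shift k0 e).
    have eT' := flow_shift k eT; rewrite (addnC k0) in eT'.
    have ed : (k + d + k0 = k + k0 + T + (d - T))%N by lia.
    have -> : (steps (k + k0) s)^-1 * steps (k + d + k0) s =
      ((steps (k + k0) s)^-1 * steps (k + k0 + T) s) *
      ((steps (k + k0 + T) s)^-1 * steps (k + k0 + T + (d - T)) s).
      by rewrite -ed !grpE.
    apply: gen_mul.
      by apply: gen_in; rewrite /c (steps_shift k eT) (addnAC k0) (addnC k0).
    apply: IH; first by lia.
    rewrite -ed eT' -(flow_shift k0 e); congr (flow _ _); lia.
  exists [:: c] => p; split=> [[k [l [a [e /L1 -> ->]]]]|].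
    rewrite gmulg1; apply: (gen_mono (S := fun y => y = c)) => [y ->|]; first by left.
    case: (leqP l k) => lk.
      by have := cycP (k - l)%N l; rewrite subnKC //; apply.
    have := cycP (l - k)%N k; rewrite subnKC ?(ltnW lk) // => /(_ (esym e)) /gen_inv.
    by rewrite !grpE.
  have sM : is_sub (fun p => fconn s p s).
    split; [exact: fconn_refl | move=> x y hx hy; exact: fconn_trans hy hx |].
    by move=> x; exact: fconn_inv.
  by apply: (gen_min sM) => y [<-|[]].
apply: (fg_ext _ (@fg_triv G)) => p; split=> [->|[k [l [a [e /L1 -> ->]]]]].
  exact: fconn_refl.
suff -> : k = l by rewrite !grpE.
case: (ltngtP k l) => // kl; case: nper.
  by exists (l - k)%N; rewrite subn_gt0; split=> //; exists k; rewrite subnKC ?(ltnW kl).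
by exists (k - l)%N; rewrite subn_gt0; split=> //; exists l; rewrite subnKC ?(ltnW kl).
Qed.

(** One connection [m] from [s] to [s'] and the finitely generated group at [s] account for all of
    them. *)
Lemma fconn_fin s s' : fin_arrows act (fun u g v => [/\ u = s', fconn s g s' & v = s]).
Proof.
case: (EM (exists p, fconn s p s')) => [[m hm]|nex]; last first.
  by exists nil; split=> // u g v [_ h _]; case: nex; exists g.
have [E [aE EP]] := fin_arrowsU (fin_arrows_loop (fconn_fg s) (fun p h => fconn_act h))
  (fin_arrows1 (fconn_act hm)).
exists E; split=> // _ g _ [-> hg ->].
have -> : g = m * (m^-1 * g) by rewrite !grpE.
have p1 : lpath (ledge E) s' m s by apply: EP; right.
apply: (lpath_cat p1); apply: EP; left; split=> //.
exact: fconn_trans hg (fconn_inv hm).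
Qed.

(** Finitely many arrows suffice: flow connections between the vertices of the finite set [S0], and
    the steps and stabilizers at the vertices of [W]. Everything else is compatible with the
    flow. *)
Lemma stabilizer_fg : fg_subgroup (fun g => act g v0 = v0).
Proof.
pose WJ := List.list_prod W (enum J).
pose S0 := v0 :: List.app W (List.map (fun wj => frep wj.2 wj.1) WJ).
have inWJ w j : List.In w W -> List.In (w, j) WJ.
  move=> wW; apply: List.in_prod => //.
  have := mem_enum J j; elim: (enum J) => // k l IH; rewrite inE => /orP [/eqP ->|/IH]; by [left|right].
have WS w : List.In w W -> List.In w S0.
  by move=> wW; right; apply: List.in_or_app; left.
have RS w j : List.In w W -> List.In (frep j w) S0.
  move=> wW; right; apply: List.in_or_app; right.
  exact: (List.in_map (fun wj => frep wj.2 wj.1) _ _ (inWJ w j wW)).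
have [E [aE EP]] : fin_arrows act (fun u g v =>
    (exists ss, List.In ss (List.list_prod S0 S0) /\ [/\ u = ss.2, fconn ss.1 g ss.2 & v = ss.1]) \/
    ((exists wj, List.In wj WJ /\ [/\ u = frep wj.2 wj.1, g = fstep wj.2 wj.1 & v = wj.1]) \/
     (exists wj, List.In wj WJ /\ [/\ u = wj.1, H wj.2 g /\ act g wj.1 = wj.1 & v = wj.1]))).
  apply: fin_arrowsU; last apply: fin_arrowsU.
  - by apply: fin_arrows_list => ss _; exact: fconn_fin.
  - by apply: fin_arrows_list => wj _; apply: fin_arrows1; case: (fstepP wj.2 wj.1).
  - apply: fin_arrows_list => wj _; apply: fin_arrows_loop; first exact: stab_fg.
    by move=> g [].
have E1 s p s' : List.In s S0 -> List.In s' S0 -> fconn s p s' -> lpath (ledge E) s' p s.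
  by move=> hs hs' h; apply: EP; left; exists (s, s'); split=> //; exact: List.in_prod.
have E2 w j : List.In w W -> lpath (ledge E) (frep j w) (fstep j w) w.
  by move=> wW; apply: EP; right; left; exists (w, j); split=> //; exact: inWJ.
have E3 w j a : List.In w W -> H j a -> act a w = w -> lpath (ledge E) w a w.
  by move=> wW Ha aw; apply: EP; right; right; exists (w, j); split=> //; exact: inWJ.
(* Invariant: [p] takes [v0] to [u] by a path of the finite graph to some [s] in [S0], then by the
   flow. *)
pose St p u := exists s q m,
  [/\ List.In s S0, lpath (ledge E) s q v0, fconn s m u & p = m * q].
have St_in s q : List.In s S0 -> lpath (ledge E) s q v0 -> St q s.
  by move=> hs h; exists s, q, 1; rewrite gmul1g; split=> //; exact: fconn_refl.
have St_to j p u : St p u -> St (fstep j u * p) (frep j u).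
  move=> Sp; case: (EM (ch u = Some j)) => cu.
    case: Sp => s [q [m [hs hq hm ->]]]; exists s, q, (fstep j u * m).
    rewrite gmulA; split=> //; have := fconn_fwd hm; by rewrite /step /next cu.
  case: (EM (frep j u = u)) => ru; first by rewrite (fstep1 ru) gmul1g ru.
  have uW := frep_W cu ru; case: Sp => s [q [m [hs hq hm ->]]].
  apply: St_in; first exact: RS.
  exact: lpath_cat (E2 _ j uW) (lpath_cat (E1 _ _ _ hs (WS _ uW) hm) hq).
have St_from j p u : St p (frep j u) -> St ((fstep j u)^-1 * p) u.
  move=> Sp; case: (EM (ch u = Some j)) => cu.
    case: Sp => s [q [m [hs hq hm ->]]]; exists s, q, ((fstep j u)^-1 * m).
    rewrite gmulA; split=> //; have := @fconn_bwd s m u; rewrite /step /next cu; exact.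
  case: (EM (frep j u = u)) => ru; first by move: Sp; rewrite (fstep1 ru) ru !grpE.
  have uW := frep_W cu ru; case: Sp => s [q [m [hs hq hm ->]]].
  apply: St_in; first exact: WS.
  exact: lpath_cat (lpath_inv (E2 _ j uW)) (lpath_cat (E1 _ _ _ hs (RS _ j uW) hm) hq).
have St_loop j p u c : H j c -> act c (frep j u) = frep j u ->
    St p (frep j u) -> St (c * p) (frep j u).
  move=> Hc ec; case: (EM (c = 1)) => [->|c1]; first by rewrite gmul1g.
  move=> [s [q [m [hs hq hm ->]]]].
  case: (EM (ch (frep j u) = Some j)) => cr.
    exists s, q, (c * m); rewrite gmulA; split=> //; apply: fconn_loop hm.
    right; exists j; split=> //; rewrite /next cr.
    exact: frep_eq (frepP j u).1.
  have rW : List.In (frep j u) W by have [|//|//] := bad_finite Hc c1 cr; rewrite ec.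
  apply: St_in; first exact: WS.
  exact: lpath_cat (E3 _ _ _ rW Hc ec) (lpath_cat (E1 _ _ _ hs (WS _ rW) hm) hq).
have St_step j a p u : H j a -> St p u -> St (a * p) (act a u).
  move=> Ha /(St_to j) Sp; set v := act a u.
  have er : frep j v = frep j u by apply: frep_eq; exists a.
  have [Hbu ebu] := fstepP j u; have [Hbv ebv] := fstepP j v.
  (* Within its orbit, [a] is a step to the representative, the loop [c] there, and a step back. *)
  pose c := fstep j v * a * (fstep j u)^-1.
  have Hc : H j c.
    apply: (subM (sH j)); [exact: (subM (sH j)) | exact: (subV (sH j))].
  have ec : act c (frep j u) = frep j u.
    by rewrite /c !actM -{1}ebu (actK act1 actM) -/v ebv er.
  have := St_loop _ _ _ _ Hc ec Sp; rewrite -er => /St_from.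
  by rewrite /c !grpE.
have St_all g : St g (act g v0).
  pose Q g := forall p u, St p u -> St (g * p) (act g u) /\ St (g^-1 * p) (act g^-1 u).
  have sQ : is_sub Q.
    split=> [p u|x y Qx Qy p u Sp|x Qx p u Sp].
    - by rewrite ginv1 gmul1g act1.
    - rewrite ginvM !gmulAr !actM; split; first by case: (Qx _ _ (Qy _ _ Sp).1).
      by case: (Qy _ _ (Qx _ _ Sp).2).
    - by rewrite ginvK; case: (Qx _ _ Sp).
  have Qg : Q g.
    apply: (gen_min sQ _ (genH g)) => x [j Hx] p u Sp.
    by split; apply: (St_step j) => //; exact: (subV (sH j)).
  have S1 : St 1 v0 by apply: St_in; [left | exact: lpath0].
  by have [] := Qg _ _ S1; rewrite gmulg1.
apply: (fg_ext _ (lpath_fg E v0)) => g; split=> [/(lpath_act act1 actM aE)//|eg].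
have := St_all g; rewrite eg => -[s [q [m [hs hq hm ->]]]].
by apply: lpath_cat (E1 _ _ _ hs _ hm) hq; left.
Qed.

End Flow.

(** * The twisted action *)

Lemma In_enum (J : finType) (j : J) : List.In j (enum J).
Proof.
have := mem_enum J j; elim: (enum J) => // k l IH.
by rewrite inE => /orP [/eqP ->|/IH]; [left|right].
Qed.

Lemma suffix_drop (T : Type) (s1 s2 m n : seq T) :
  s1 ++ m = s2 ++ n -> (size n <= size m)%N -> n = drop (size m - size n) m.
Proof.
move=> e nm.
have sz : (size s1 + size m = size s2 + size n)%N by rewrite -!size_cat e.
have en : n = drop (size s2) (s2 ++ n) by rewrite drop_size_cat.
rewrite {1}en -e drop_cat; case: ltnP => h; first by lia.
by congr drop; lia.
Qed.

Lemma winv_cat (G : AbsGroup) (I : eqType) (u v : seq (I * G)) :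
  winv (u ++ v) = winv v ++ winv u.
Proof. by rewrite /winv map_cat rev_cat. Qed.

Lemma In_winv (G : AbsGroup) (I : eqType) (w : seq (I * G)) s :
  List.In s (winv w) -> List.In s (List.map (fun t => (t.1, t.2^-1)) w).
Proof.
elim: w => // t w IH; rewrite winv_cons.
by move=> /(List.in_app_or (winv w)) [/IH|[<-|[]]]; [right|left].
Qed.

Section TwistedAction.
Variables (G : AbsGroup) (J : eqType) (X : J -> G -> Prop).
Hypothesis fG : FP (fun _ : G => True) X.
Let sX := FP_factor fG.
Local Notation nf := (nf X).

Let nf_red x : reduced X (nf x). Proof. by have [] := nfP fG (x := x) Logic.I. Qed.
Let nf_val x : eval (nf x) = x. Proof. by have [] := nfP fG (x := x) Logic.I. Qed.

Lemma nf_conj_cons v j a u : X j a -> a <> 1 -> first (nf v) <> Some j ->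
  first (nf u) <> Some j -> nf (v^-1 * a * u) = winv (nf v) ++ (j, a) :: nf u.
Proof.
move=> Xa a1 fv fu.
have -> : v^-1 * a * u = eval (winv (nf v) ++ (j, a) :: nf u).
  by rewrite eval_cat eval_winv /= !nf_val !grpE.
by apply: (nf_eval fG); apply: reduced_winv_cons.
Qed.

Lemma nfV x : nf x^-1 = winv (nf x).
Proof.
by rewrite -{1}(nf_val x) -eval_winv (nf_eval fG) //; apply: reduced_winv.
Qed.

Lemma nf_push i x y : X i x -> nf (x * y) = push i x (nf y).
Proof.
move=> Xx; rewrite -{1}(nf_val y) -(eval_push i) (nf_eval fG) //.
exact: reduced_push.
Qed.

Lemma size_nf_word w : (forall s, List.In s w -> X s.1 s.2) ->
  (size (nf (eval w)) <= size w)%N.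
Proof.
elim: w => [_|[i x] w IH h]; first by rewrite (nf1 fG).
have Xx : X i x := h _ (or_introl erefl).
rewrite /= (nf_push _ Xx).
have {}IH := IH (fun s sw => h s (or_intror sw)).
apply: (leq_trans _ (_ : (size (nf (eval w))).+1 <= _)%N) => //.
case: (nf (eval w)) => [|[j y] t]; rewrite /push /cons1; first by case: asboolP.
by case: eqP => _; case: asboolP => //= _; lia.
Qed.

(** The list [L'] is uniform in [x]: each [push] by a syllable of [p] creates at most one new
    syllable, of a form listed in [In_push]. *)
Lemma syllables_mul p L : exists L', forall x,
  (forall s, List.In s (nf x) -> List.In s L) ->
  forall s, List.In s (nf (p * x)) -> List.In s L'.
Proof.
rewrite -(nf_val p); have [vp _] := nf_red p; elim: (nf p) vp => [_|[i y] w IH].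
  by exists L => x h s; rewrite /= gmul1g; apply: h.
move=> /= [[Xy _] /IH [L' LP]].
exists ((i, y) :: List.app L' (List.map (fun t => (i, y * t.2)) L')) => x /LP h s.
rewrite gmulAr (nf_push _ Xy) => /In_push [<-|]; first by left.
move=> sw; right; apply: List.in_or_app.
have [/h|/List.in_map_iff [t [<- /h tL]]] := List.in_app_or _ _ _ sw; first by left.
by right; apply: (List.in_map (fun t => (i, y * t.2))).
Qed.

Lemma syllables_inv L x : (forall s, List.In s (nf x) -> List.In s L) ->
  forall s, List.In s (nf x^-1) -> List.In s (List.map (fun t => (t.1, t.2^-1)) L).
Proof.
move=> h s; rewrite nfV => /In_winv /List.in_map_iff [t [<- /h tL]].
exact: (List.in_map (fun t => (t.1, t.2^-1))).
Qed.

(** Right multiplication by [p] is left multiplication by [p^-1] between two inversions. *)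
Lemma syllables_conj p L : exists L', forall x,
  (forall s, List.In s (nf x) -> List.In s L) ->
  forall s, List.In s (nf (p^-1 * x * p)) -> List.In s L'.
Proof.
have [L1 h1] := syllables_mul p^-1 (List.map (fun t => (t.1, t.2^-1)) L).
have [L2 h2] := syllables_mul p^-1 (List.map (fun t => (t.1, t.2^-1)) L1).
exists L2 => x /syllables_inv /h1 /syllables_inv /h2.
by rewrite !grpE.
Qed.

Definition wpow (w : seq (J * G)) n := iter n (cat w) [::].

Lemma In_wpow w n s : List.In s (wpow w n) -> List.In s w.
Proof. by elim: n => // n IH /(List.in_app_or w) [|/IH]. Qed.

(** [first (winv w)] is the index of the last syllable of [w], so the hypothesis says that [w] is
    cyclically reduced. *)
Lemma reduced_wpow w n : reduced X w -> first (winv w) <> first w -> reduced X (wpow w n).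
Proof.
case: w => [|t w] rw fw; first by elim: n.
have fE m : first (wpow (t :: w) m.+1) = first (t :: w) by [].
elim: n => [//|n IH]; rewrite /wpow iterS -{1}[_ :: _]winvK.
apply: reduced_winv_cat => //; first exact: reduced_winv.
case: n IH => [|n] IH i fi //; rewrite -/(wpow _ n.+1) fE => e.
by apply: fw; rewrite fi e.
Qed.

Lemma eval_wpow_comm w n : eval (wpow w n) * eval w = eval w * eval (wpow w n).
Proof. by elim: n => [|n IH]; rewrite /= ?grpE // eval_cat gmulAr IH. Qed.

Lemma cyc_wpow w x : cyc (eval w) x ->
  exists n, x = eval (wpow w n) \/ x = (eval (wpow w n))^-1.
Proof.
pose P y := exists n, y = eval (wpow w n) \/ y = (eval (wpow w n))^-1.
have wP y : P y -> P (eval w * y) /\ P ((eval w)^-1 * y).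
  move=> [n [->|->]]; split.
  - by exists n.+1; left; rewrite /= eval_cat.
  - case: n => [|n]; first by exists 1%N; right; rewrite /= eval_cat /= !grpE.
    by exists n; left; rewrite /= eval_cat !grpE.
  - case: n => [|n]; first by exists 1%N; left; rewrite /= eval_cat /= !grpE.
    by exists n; right; rewrite /= eval_cat -eval_wpow_comm !grpE.
  - by exists n.+1; right; rewrite /= eval_cat -eval_wpow_comm !grpE.
pose Q y := forall z, P z -> P (y * z) /\ P (y^-1 * z).
have sQ : is_sub Q.
  split=> [z|y z Qy Qz u Pu|y Qy z /Qy]; rewrite !grpE //; last by case.
  by split; [case: (Qy _ (Qz _ Pu).1) | case: (Qz _ (Qy _ Pu).2)].
have Qw y : y = eval w -> Q y by move=> -> z /wP.
move=> gx; have P1 : P 1 by exists 0%N; left.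
by have [] := gen_min sQ Qw gx _ P1; rewrite gmulg1.
Qed.

Variable f : G -> G.
Hypotheses (hf : homOn (fun _ => True) f) (fI : injective f).
Hypothesis iX : forall j, indecomposable (X j).

Let f1 : f 1 = 1. Proof. exact: (homOn1 (@sub_top G) hf). Qed.
Let fM x y : f (x * y) = f x * f y. Proof. exact: hf. Qed.

Definition tact p u := p * u * (f p)^-1.

Lemma tact1 u : tact 1 u = u.
Proof. by rewrite /tact f1 !grpE. Qed.

Lemma tactM p q u : tact (p * q) u = tact p (tact q u).
Proof. by rewrite /tact fM !grpE. Qed.

(** The stabilizer of [u] in [X j] is the fixed subgroup of [c], that is [f] followed by
    conjugation. A nontrivial fixed point forces [c] to preserve [X j]; for automorphisms the same
    argument applied to the inverse of [c] gives surjectivity. *)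
Lemma tact_stab_fg (b : bool) j u : (b -> forall y, exists x, f x = y) ->
  FGFPon b (X j) -> fg_subgroup (fun a => X j a /\ tact a u = u).
Proof.
move=> fS fgX.
pose c x := u * f x * u^-1.
have cM : homOn (fun _ => True) c by move=> x y _ _; rewrite /c fM !grpE.
have cI : injective c.
  move=> x y /(congr1 (fun z => u^-1 * z * u)); rewrite /c !grpE; exact: fI.
have stabE a : tact a u = u <-> c a = a.
  rewrite /tact /c; split=> e; last by rewrite -{1}e !grpE.
  by rewrite -{1}e !grpE.
case: (EM (exists a, [/\ X j a, a <> 1 & c a = a])) => [[a0 [Xa0 a01 ca0]]|nE]; last first.
  apply: (fg_ext _ (@fg_triv G)) => a; split=> [->|[Xa /stabE ca]].
    by rewrite tact1; split=> //; exact: (sub1 (sX j)).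
  by apply: contrapT => a1; apply: nE; exists a.
have cX a : X j a -> X j (c a).
  apply: (indecomposable_elliptic fG (sX j) (@iX j) cM cI).
  by exists a0; rewrite ca0.
apply: (fg_ext _ (fgX c _ cX _ _)) => [a|x y _ _|x y _ _ /cI //|bT y Xy].
- by rewrite stabE.
- exact: cM.
have /choice [c' cK] : forall y, exists x, c x = y.
  move=> z; have [x ex] := fS bT (u^-1 * z * u); exists x.
  by rewrite /c ex !grpE.
have cK' x : c' (c x) = x by apply: cI; rewrite cK.
have c'M : homOn (fun _ => True) c'.
  by move=> x z _ _; apply: cI; rewrite cM // !cK.
have c'I : injective c' by apply: can_inj cK.
exists (c' y) => //.
apply: (indecomposable_elliptic fG (sX j) (@iX j) c'M c'I) Xy.
by exists a0; rewrite -{3}ca0 cK'.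
Qed.

Definition bad_set j (W : list G) := forall u a, X j a -> a <> 1 ->
  first (nf u) <> Some j -> first (nf (tact a u)) <> Some j ->
  List.In u W \/ List.In (tact a u) W.

(** No cancellation occurs in [f a] = v^-1 a u, so [u] and v = [tact a u] can be read off from the
    two ends of one normal form. *)
Lemma nf_bad j u a : X j a -> a <> 1 -> first (nf u) <> Some j ->
  first (nf (tact a u)) <> Some j ->
  nf (f a) = winv (nf (tact a u)) ++ (j, a) :: nf u.
Proof.
move=> Xa a1 fu fv.
have e : f a = (tact a u)^-1 * a * u by rewrite /tact !grpE.
by rewrite e (nf_conj_cons Xa a1 fv fu).
Qed.

Definition suffixes (w : seq (J * G)) : list G :=
  List.map (fun d => eval (drop d w)) (List.seq 0 (size w).+1).

Lemma In_suffixes w d : (d <= size w)%N -> List.In (eval (drop d w)) (suffixes w).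
Proof.
move=> dw; apply: (List.in_map (fun d => eval (drop d w))).
by apply/List.in_seq; split; apply/leP.
Qed.

(** The two reduced words v^-1 a u and w^-1 c w spell the same element [f a]. The shorter right end
    is a suffix of the longer one; if [u] is longer than [w], then v is shorter, and inverting the
    words makes v the suffix. *)
Lemma bad_elliptic j w k : (forall a, X j a -> X k (w * f a * w^-1)) ->
  exists W, bad_set j W.
Proof.
move=> ell.
wlog fw : w ell / first (nf w) <> Some k.
  move=> WL; case: (EM (first (nf w) = Some k)) => [fw|]; last exact: WL.
  move: fw (nf_red w) (nf_val w); case: (nf w) => [//|[i y] t] [ik].
  subst i => /reduced_cons [Xy _ ft rt] ew.
  apply: (WL (eval t)); last by rewrite (nf_eval fG).
  move=> a /ell; rewrite -ew /= => Xa.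
  have := subM (sX k) (subM (sX k) (subV (sX k) Xy) Xa) Xy.
  by rewrite !grpE.
exists (suffixes (nf w)) => u a Xa a1 fu fv.
have Xc := ell _ Xa; set c := w * f a * w^-1 in Xc.
have c1 : c <> 1.
  move=> e; apply: a1; apply: fI; rewrite f1.
  have -> : f a = w^-1 * c * w by rewrite /c !grpE.
  by rewrite e !grpE.
have e1 := nf_bad Xa a1 fu fv.
have e2 := nf_conj_cons Xc c1 fw fw.
have ec : w^-1 * c * w = f a by rewrite /c !grpE.
rewrite ec e1 in e2; set v := tact a u in e2 fv *.
case: (leqP (size (nf u)) (size (nf w))) => le.
  left; rewrite -(nf_val u).
  move: e2; rewrite -!cat_rcons => /esym /suffix_drop -/(_ le) ->.
  by apply: In_suffixes; lia.
right; rewrite -(nf_val v).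
have szw (l : seq (J * G)) : size (winv l) = size l by rewrite /winv size_rev size_map.
have le' : (size (nf v) <= size (nf w))%N.
  have := congr1 size e2; rewrite !size_cat !szw /=; lia.
have := congr1 (@winv G J) e2; rewrite !winv_cat !winv_cons !winvK -!catA.
rewrite !catA => /esym /suffix_drop -/(_ le') ->.
by apply: In_suffixes; lia.
Qed.

(** A shortest conjugate [c] of [f z] is cyclically reduced unless it lies in a factor, the elliptic
    case. Its powers use only the syllables of [c] and their inverses, so all [f a] have syllables
    in one finite list [L]. As [a] is itself such a syllable, only finitely many [a] occur. *)
Lemma bad_hyperbolic j z : X j z -> (forall a, X j a -> cyc (f z) (f a)) ->
  exists W, bad_set j W.
Proof.
move=> Xz cycf.
have [p [_ pmin]] := exists_min (fun p => size (nf (p * f z * p^-1)))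
  (ex_intro (fun _ => True) (1 : G) Logic.I).
set c := p * f z * p^-1 in pmin.
have cycc a : X j a -> cyc c (p * f a * p^-1).
  move=> /cycf; apply: (gen_min (A := fun x => cyc c (p * x * p^-1))) => [|x ->].
    split=> [|x y hx hy|x hx].
    - by rewrite !grpE; exact: gen_one.
    - by move: (gen_mul hx hy); rewrite !grpE.
    - by move: (gen_inv hx); rewrite !grpE.
  exact: gen_in.
have ell k : X k c -> exists W, bad_set j W.
  move=> Xc; apply: (@bad_elliptic j p k) => a /cycc.
  by apply: (gen_min (sX k)) => x ->.
have := nf_val c; have := nf_red c.
case ec : (nf c) => [|[k y] t] rc vc.
  by apply: (ell j); rewrite -vc; exact: (sub1 (sX j)).
have [[Xy y1] vt'] := rc.1; rewrite /= in Xy y1 vc.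
have {vt'} vt : valid X t := vt'.
case/lastP: t => [|t [k' y']] in ec rc vc vt.
  by apply: (ell k); rewrite -vc /= gmulg1.
(* Otherwise conjugation by the first syllable would merge it with the last one and shorten [c]. *)
have kk' : k' <> k.
  move=> ek; subst k'; have /= := pmin (y^-1 * p) Logic.I.
  move: vt; rewrite -cats1 valid_cat => -[vt [[/= Xy' _] _]].
  have -> : y^-1 * p * f z * (y^-1 * p)^-1 = eval (rcons t (k, y' * y)).
    have -> : y^-1 * p * f z * (y^-1 * p)^-1 = y^-1 * c * y by rewrite /c !grpE.
    by rewrite -vc -!cats1 !eval_cat /= !grpE.
  rewrite ec leqNgt => /negP; apply.
  apply: (leq_ltn_trans (size_nf_word _)); last by rewrite /= !size_rcons.
  move=> s; rewrite -cats1 => /(List.in_app_or t) [st|[<-|[]]]; last exact: (subM (sX k) Xy' Xy).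
  by elim: (t) vt st => [_ []|r l IH /= [[Xr _] vl] [<- //|/IH]]; apply.
set w := (k, y) :: rcons t (k', y') in ec rc.
have fw : first (winv w) <> first w.
  by rewrite /first unzip1_winv /w /= /unzip1 map_rcons rev_cons rev_rcons /= => -[].
have [L LP] := syllables_conj p (List.app w (winv w)).
have synt a : X j a -> forall s, List.In s (nf (f a)) -> List.In s L.
  move=> Xa; have -> : f a = p^-1 * (p * f a * p^-1) * p by rewrite !grpE.
  apply: LP => s; have : cyc (eval w) (p * f a * p^-1).
    by rewrite -ec nf_val; exact: cycc.
  move=> /cyc_wpow [n [->|->]] sn; apply: List.in_or_app.
    by left; move: sn; rewrite (nf_eval fG); [exact: In_wpow | exact: reduced_wpow].
  right; move: sn; rewrite nfV (nf_eval fG); last exact: reduced_wpow.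
  move=> /In_winv /List.in_map_iff [r [<- /In_wpow rw]].
  rewrite /winv; move: rw; clear; elim: w => // q w IH.
  rewrite -/(winv _) winv_cons => -[->|/IH h]; apply: List.in_or_app; first by right; left.
  by left.
exists (List.flat_map (fun s => suffixes (nf (f s.2))) L) => u a Xa a1 fu fv.
left; apply/List.in_flat_map; exists (j, a).
have e := nf_bad Xa a1 fu fv; split.
  by apply: (synt a Xa); rewrite e; apply: List.in_or_app; right; left.
suff : List.In (eval (nf u)) (suffixes (nf (f a))) by rewrite nf_val.
have -> : nf u = drop (size (winv (nf (tact a u)))).+1 (nf (f a)).
  by rewrite e -cat_rcons drop_size_cat ?size_rcons.
apply: In_suffixes; rewrite e size_cat /=; lia.
Qed.

Lemma bad_set_exists j : exists W, bad_set j W.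
Proof.
case: (EM (exists a, X j a /\ a <> 1)) => [nt|triv]; last first.
  by exists nil => u a Xa a1; case: triv; exists a.
case: (EM (exists k w a, [/\ X j a, a <> 1 & X k (w * f a * w^-1)])) => [|nell].
  move=> [k [w [a0 [Xa0 a01 Xc]]]].
  pose c x := w * f x * w^-1.
  have cM : homOn (fun _ => True) c by move=> x y _ _; rewrite /c fM !grpE.
  have cI : injective c.
    move=> x y /(congr1 (fun z => w^-1 * z * w)); rewrite /c !grpE; exact: fI.
  apply: (@bad_elliptic j w k).
  by apply: (indecomposable_elliptic fG (sX j) (@iX j) cM cI); exists a0.
have [|z Xz cz] := indecomposable_hyperbolic fG (sX j) (@iX j) hf fI nt.
  move=> k u a Xa Xc; apply: contrapT => a1; apply: nell.
  by exists k, u^-1, a; rewrite ginvK.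
exact: bad_hyperbolic Xz cz.
Qed.

End TwistedAction.

(** * Assembling the theorem *)

Lemma fix_fg (b : bool) (G : AbsGroup) (J : finType) (X : J -> G -> Prop) (f : G -> G) :
  FP (fun _ : G => True) X -> homOn (fun _ => True) f -> injective f ->
  (b -> forall y, exists x, f x = y) ->
  (forall j, indecomposable (X j)) -> (forall j, FGFPon b (X j)) ->
  fg_subgroup (fun x => f x = x).
Proof.
move=> fG hf fI fS iX fgX.
have /choice [W WP] := bad_set_exists fG hf fI iX.
pose W0 := List.flat_map W (enum J).
have bad j u a : X j a -> a <> 1 -> first (nf X u) <> Some j ->
    first (nf X (tact f a u)) <> Some j -> List.In u W0 \/ List.In (tact f a u) W0.
  move=> Xa a1 fu fv; have [h|h] := WP j u a Xa a1 fu fv; [left|right];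
  by apply/List.in_flat_map; exists j; split=> //; exact: In_enum.
have := stabilizer_fg (tact1 hf) (tactM hf) (FP_factor fG)
  (fun x => FP_gen fG (x := x) Logic.I) bad 
  (fun j u => tact_stab_fg fG hf fI iX u fS (fgX j)) 1.
apply: fg_ext => x; rewrite /tact gmulg1; split=> [/gmul_eq1 //|->].
by rewrite gmulgV.
Qed.

Lemma FGFPon_free_product (b : bool) (G : AbsGroup) (I : finType) (X : I -> G -> Prop) :
  FP (fun _ : G => True) X -> (forall i, fg_subgroup (X i)) ->
  FGFPon b (fun _ : G => True) <-> forall i, FGFPon b (X i).
Proof.
move=> fG fgX; split=> [fgG i|fX]; first exact: FGFPon_factor fG fgG.
have /choice [D DP] : forall i, exists D : {J : finType & J -> G -> Prop},
    FP (X i) (projT2 D) /\ forall j, indecomposable (projT2 D j).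
  by move=> i; have [J [Y hY]] := indecomposable_factors (fgX i); exists (existT _ J Y).
have fY := FP_trans fG (fun i => (DP i).1).
move=> f hf _ fI fS.
have fI' : injective f by move=> x y; apply: fI.
apply: (fg_ext _ (@fix_fg b G _ _ f fY hf fI' _ _ _)) => [x|bT y|[i j]|[i j]].
- by split=> [|[]].
- by have [x _ <-] := fS bT y Logic.I; exists x.
- exact: (DP i).2.
- exact: FGFPon_factor (DP i).1 (fX i).
Qed.

Theorem mainTheorem10 (n : nat) (Gs : 'I_n -> AbsGroup)
  (P : AbsGroup) (inj : forall i, Gs i -> P) :
  (forall i, nontrivial (Gs i)) ->
  (forall i, fg_group (Gs i)) ->
  @is_free_product _ Gs P inj ->
  (FGFP_m P <-> (forall i, FGFP_m (Gs i))) /\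
  (FGFP_a P <-> (forall i, FGFP_a (Gs i))).
Proof.
move=> _ fgGs fp; have fP := FP_of_free_product fp.
have hi i : homOn (fun _ => True) (inj i) by apply/is_hom_homOn; exact: fp.1.
have im_top i y : (exists2 x, True & inj i x = y) <-> exists x, inj i x = y.
  by split=> [[x _ <-]|[x <-]]; exists x.
have fgX i : fg_subgroup (fun y => exists x, inj i x = y).
  exact: (fg_ext (im_top i) (fg_im (@sub_top _) (hi i) (fgGs i))).
(* The property passes between [Gs i] and its image in [P] along [inj i] and its inverse [g]. *)
have factorE b i : FGFPon b (fun _ : Gs i => True) <->
    FGFPon b (fun y => exists x, inj i x = y).
  have -> : (fun y => exists x, inj i x = y) = (fun y => exists2 x, True & inj i x = y).
    by apply: funext => y; apply: propext; rewrite im_top.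
  have injI x y : True -> True -> inj i x = inj i y -> x = y.
    by move=> _ _; apply: (free_product_inj fp).
  split; first exact: FGFPon_im (@sub_top _) (hi i) injI.
  have [g gK] := injOn_inv injI.
  have gM : homOn (fun y => exists2 x, True & inj i x = y) g.
    by move=> _ _ [x _ <-] [y _ <-]; rewrite -hi // !gK.
  have gI x y : (exists2 z, True & inj i z = x) -> (exists2 z, True & inj i z = y) ->
      g x = g y -> x = y.
    by move=> [z _ <-] [t _ <-]; rewrite !gK // => ->.
  move=> /(FGFPon_im (sub_im (@sub_top _) (hi i)) gM gI).
  have -> // : (fun y => exists2 x, exists2 z, True & inj i z = x & g x = y) =
    (fun _ : Gs i => True).
  apply: funext => x; apply: propext; split=> // _.
  by exists (inj i x); [exists x | rewrite gK].
have main b : FGFPon b (fun _ : P => True) <-> forall i, FGFPon b (fun _ : Gs i => True).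
  rewrite (FGFPon_free_product b fP fgX).
  by split=> h i; apply/factorE.
split; first by rewrite FGFPon_m main; split=> h i; apply/FGFPon_m.
by rewrite FGFPon_a main; split=> h i; apply/FGFPon_a.
Qed.
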